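(* The metric space $(\mathcal{PM},d_{LP})$ is complete; that is, every $d_{LP}$-Cauchy sequence in $\mathcal{PM}$ converges in $d_{LP}$ to an element of $\mathcal{PM}$.
   Context: Fix $T>0$. For a (nonempty) compact metric space $(X,d)$, $\mathcal C(X)$ is the space of continuous maps $[0,T]\to X$ with the uniform metric $d_{\mathcal C}(v,w)=\sup_{t\in[0,T]}d(v(t),w(t))$. For a subset $A$ of $\mathcal C(X)$ and $a\ge 0$, $A^a=\{x\in\mathcal C(X): d_{\mathcal C}(x,A)<a\}$. For a continuous map $f:X\to Y$, $\Phi_f:\mathcal C(X)\to\mathcal C(Y)$ is defined by $\Phi_f(v)(t)=f(v(t))$, and ${\Phi_f}_*P$ denotes the push-forward measure. An isometry is a surjective distance-preserving map. For a bi-Lipschitz homeomorphism $f:X\to Y$ of metric spaces, $\mathrm{dil}(f)=\sup_{x\ne y}\frac{d(f(x),f(y))}{d(x,y)}$ (with $\mathrm{dil}(f)=1$ if $X$ is a single point). For $\varepsilon\ge 0$, a bi-Lipschitz homeomorphism $f$ is an $\varepsilon$-isometry if $|\log\mathrm{dil}(f)|+|\log\mathrm{dil}(f^{-1})|\le\varepsilon$. Two pairs $(X,P)$, $(Y,Q)$ (compact metric space, Borel probability measure on its path space $\mathcal C(\cdot)$) are isomorphic if there is an isometry $f:X\to Y$ with ${\Phi_f}_*P=Q$. $\mathcal{PM}$ is the set of isomorphism classes of such pairs. For $\varepsilon,\delta\ge 0$, a map $f:(X,P)\to(Y,Q)$ is an $(\varepsilon,\delta)$-isomorphism if $f:X\to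 Y$ is an $\varepsilon$-isometry and for all Borel sets $A\subset\mathcal C(Y)$ and $B\subset\mathcal C(X)$: $${\Phi_f}_*P(A)\le Q(A^{\delta e^{\varepsilon}})+\delta e^{\varepsilon},\quad Q(A)\le{\Phi_f}_*P(A^{\delta e^{\varepsilon}})+\delta e^{\varepsilon},$$ $${\Phi_{f^{-1}}}_*Q(B)\le P(B^{\delta e^{\varepsilon}})+\delta e^{\varepsilon},\quad P(B)\le{\Phi_{f^{-1}}}_*Q(B^{\delta e^{\varepsilon}})+\delta e^{\varepsilon}.$$ The Lipschitz--Prokhorov distance, a metric on $\mathcal{PM}$ allowed to take the value $\infty$, is $$d_{LP}((X,P),(Y,Q))=\inf\{\varepsilon+\delta\ge 0:\ \text{there exists an }(\varepsilon,\delta)\text{-isomorphism } f:(X,P)\to(Y,Q)\},$$ and $d_{LP}=\infty$ if no such $f$ exists. *)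

(* Defs.v *)
From HB Require Import structures.
From mathcomp Require Import all_boot all_order all_algebra.
From mathcomp Require Import all_classical all_reals all_analysis.
Import Order.TTheory GRing.Theory Num.Theory.
Import numFieldNormedType.Exports.

Set Implicit Arguments.
Unset Strict Implicit.
Unset Printing Implicit Defensive.

Local Open Scope classical_set_scope.
Local Open Scope ring_scope.

Record compactMetric (R : realType) := CompactMetric {
  cm_sort :> metricType R ;
  cm_nonempty : [set: cm_sort] !=set0 ;
  cm_compact : compact [set: cm_sort] }.

Lemma compactMetric_bounded (R : realType) (X : compactMetric R) :
  exists M : R, forall x y : X, mdist x y <= M.
Proof.
have [x0 _] := cm_nonempty X.
have /compact_near_coveringP cX := @cm_compact _ X.
have [|N _ HN] := cX nat \oo (fun n x => mdist x0 x < n%:R) _.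
  move=> x _.
  exists (ball x 1, [set n | mdist x0 x + 1 <= n%:R]) => /=.
    split; first exact: nbhsx_ballx.
    exact: nbhs_infty_ger.
  move=> [y n] /= [xy xn]; apply: lt_le_trans xn.
  rewrite ballEmdist /= in xy.
  by rewrite (le_lt_trans (metric_triangle _ x _))// ltrD2l.
exists (N%:R + N%:R) => x y; apply: le_trans (metric_triangle _ x0 _) _.
have H z : mdist x0 z <= N%:R by apply: ltW; apply: (HN N) => /=.
by rewrite lerD// metric_sym.
Qed.

Definition pathSpace (R : realType) (T : R) (X : compactMetric R) : Type :=
  continuousType (set_type `[0, T]) X.

HB.instance Definition _ (R : realType) (T : R) (X : compactMetric R) :=
  Choice.on (pathSpace T X).

Definition dC (R : realType) (T : R) (X : compactMetric R) (v w : pathSpace T X) : R :=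
  sup [set mdist (v t) (w t) | t in [set: set_type `[0, T]]].

Section path_metric.
Context (R : realType) (T : R) (X : compactMetric R).
Implicit Types v w : pathSpace T X.

Let values v w := [set mdist (v t) (w t) | t in [set: set_type `[0, T]]].

Let dC_ubound v w : has_ubound (values v w).
Proof.
by have [M HM] := compactMetric_bounded X; exists M => _ [t _ <-].
Qed.

Lemma dC_ge v w t : mdist (v t) (w t) <= dC v w.
Proof. by apply: ub_le_sup; [exact: dC_ubound|exists t]. Qed.

Lemma dC_le v w (M : R) : 0 <= M -> (forall t, mdist (v t) (w t) <= M) ->
  dC v w <= M.
Proof.
move=> M0 HM; have [/set0P v0|v0] := boolP (values v w != set0).
  by apply: ge_sup => // _ [t _ <-].
by move/negP: v0 => /negP/negPn/eqP v0; rewrite /dC -/(values v w) v0 sup0.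
Qed.

Let dC_ge0 v w : 0 <= dC v w.
Proof.
have [/set0P[_ [t _ _]]|v0] := boolP (values v w != set0).
  by apply: le_trans (dC_ge v w t); exact: mdist_ge0.
by move/negPn/eqP: v0 => v0; rewrite /dC -/(values v w) v0 sup0.
Qed.

Let dCxx v : dC v v = 0.
Proof.
by apply/eqP; rewrite eq_le dC_ge0 andbT; apply: dC_le => // t; rewrite mdistxx.
Qed.

Let dC_eq0 v w : dC v w = 0 -> v = w.
Proof.
move=> vw; apply/continuousEP => t; apply: mdist_positivity.
by apply/eqP; rewrite eq_le mdist_ge0 andbT; have := dC_ge v w t; rewrite vw.
Qed.

Let dC_sym v w : dC v w = dC w v.
Proof. by rewrite /dC; congr sup; apply: eq_imagel => t _; rewrite metric_sym. Qed.

Let dC_triangle w v z : dC v z <= dC v w + dC w z.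
Proof.
apply: dC_le => [|t]; first by rewrite addr_ge0.
by apply: le_trans (metric_triangle _ (w t) _) _; rewrite lerD// dC_ge.
Qed.

HB.instance Definition _ := @isMetric.Build R (pathSpace T X) (@dC R T X)
  dCxx dC_eq0 dC_sym dC_triangle.

Let path_point : pathSpace T X :=
  mkcts (fun _ => @cst_continuous (set_type `[0, T]) X (projT1 (cid (cm_nonempty X))) _).

HB.instance Definition _ := isPointed.Build (pathSpace T X) path_point.

(* The Borel sigma-algebra of the uniform metric. *)
HB.instance Definition _ := @isMeasurable.Build
  (sigma_display (@open (pathSpace T X))) (pathSpace T X) <<s @open (pathSpace T X) >>
  (@sigma_algebra0 _ setT _) (@sigma_algebraC _ _) (@sigma_algebra_bigcup _ setT _).

End path_metric.

(* The distance to a set is taken in the extended reals: it is +oo for the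
   empty set, so every enlargement of the empty set is empty. *)
Definition enlargement (R : realType) (M : metricType R) (A : set M) (a : R) :
    set M :=
  [set x | (ereal_inf [set (mdist x y)%:E | y in A] < a%:E)%E].

Definition Phi (R : realType) (T : R) (X Y : compactMetric R)
    (f : continuousType X Y) (v : pathSpace T X) : pathSpace T Y :=
  (f \o v : continuousType _ _).

Lemma enlargementP (R : realType) (M : metricType R) (A : set M) (a : R) x :
  enlargement A a x <-> exists2 y, A y & mdist x y < a.
Proof.
rewrite /enlargement /=; split.
  move=> /ereal_inf_lt[_ [y Ay <-]]; rewrite lte_fin => xy.
  by exists y.
move=> [y Ay xy]; apply: (@le_lt_trans _ _ (mdist x y)%:E); last by rewrite lte_fin.
by apply: ereal_inf_lbound; exists y.
Qed.

Lemma enlargement_open (R : realType) (M : metricType R) (A : set M) (a : R) :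
  open (enlargement A a).
Proof.
rewrite openE => x /enlargementP[y Ay xy]; rewrite /interior.
apply/nbhs_ballP; exists (a - mdist x y) => /=; first by rewrite subr_gt0.
move=> z; rewrite ballEmdist /= => xz; apply/enlargementP; exists y => //.
rewrite (le_lt_trans (metric_triangle _ x _))// metric_sym.
by rewrite -ltrBrDr.
Qed.

Lemma enlargement_measurable (R : realType) (T : R) (X : compactMetric R)
  (A : set (pathSpace T X)) (a : R) : measurable (enlargement A a).
Proof. by apply: sub_sigma_algebra; exact: enlargement_open. Qed.

Lemma compact_equicontinuous (R : realType) (X Y : compactMetric R)
    (f : continuousType X Y) (e : R) : 0 < e ->
  exists2 d : R, 0 < d & forall x x', mdist x x' < d -> mdist (f x) (f x') < e.
Proof.
move=> e0; have /compact_near_coveringP cX := @cm_compact _ X.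
have [|d /= d0 Hd] := cX R (0^'+)
    (fun d x => forall x', mdist x x' < d -> mdist (f x) (f x') < e) _.
  move=> x _.
  have e20 : 0 < e / 2 by rewrite divr_gt0.
  have := @cts_fun _ _ f x _ (nbhsx_ballx (f x) _ e20).
  move=> /nbhs_ballP[r /= r0 Hr].
  have r20 : 0 < r / 2 by rewrite divr_gt0.
  exists (ball x (r / 2), [set d | d < r / 2]) => /=.
    by split; [exact: nbhsx_ballx|exact: nbhs_right_lt].
  move=> [y d] /= [xy dr] x' yx'.
  rewrite ballEmdist /= in xy.
  have fy : mdist (f x) (f y) < e / 2.
    have : ball x r y.
      by rewrite ballEmdist /= (lt_le_trans xy)// ler_pdivrMr// ler_pMr// ler1n.
    by move=> /Hr; rewrite /= ballEmdist.
  have fx' : mdist (f x) (f x') < e / 2.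
    have : ball x r x'.
      rewrite ballEmdist /= (le_lt_trans (metric_triangle _ y _))//.
      by rewrite (splitr r) ltrD// (lt_trans yx').
    by move=> /Hr; rewrite /= ballEmdist.
  rewrite (le_lt_trans (metric_triangle _ (f x) _))//.
  by rewrite (splitr e) ltrD// metric_sym.
exists (d / 2); first by rewrite divr_gt0.
move=> x x' xx'; apply: (Hd (d / 2)) => //=; last by rewrite divr_gt0.
by rewrite sub0r normrN gtr0_norm ?divr_gt0// ltr_pdivrMr// ltr_pMr// ltr1n.
Qed.

Lemma Phi_continuous (R : realType) (T : R) (X Y : compactMetric R)
  (f : continuousType X Y) : continuous (Phi (T := T) f).
Proof.
move=> v A /nbhs_ballP[e /= e0 eA]; apply/nbhs_ballP.
have e20 : 0 < e / 2 by rewrite divr_gt0.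
have [d d0 Hd] := compact_equicontinuous f e20.
exists d => //= w vw; apply: eA; rewrite ballEmdist /= in vw.
rewrite ballEmdist /=; apply: (@le_lt_trans _ _ (e / 2)).
  by apply: dC_le => [|t]; [exact: ltW|exact/ltW/Hd/(le_lt_trans (dC_ge v w t))].
by rewrite ltr_pdivrMr// ltr_pMr// ltr1n.
Qed.

Lemma Phi_measurable (R : realType) (T : R) (X Y : compactMetric R)
  (f : continuousType X Y) : measurable_fun setT (Phi (T := T) f).
Proof.
apply: (measurability (@open (pathSpace T Y))) => // _ [B oB <-].
rewrite setTI; apply: sub_sigma_algebra.
by apply: open_comp => // v _; exact: Phi_continuous.
Qed.

Definition isometry (R : realType) (X Y : metricType R) (f : X -> Y) :=
  (forall y, exists x, f x = y) /\
  (forall x x', mdist (f x) (f x') = mdist x x').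

Definition lipschitzMap (R : realType) (X Y : metricType R) (f : X -> Y) :=
  exists k : R, forall x x', mdist (f x) (f x') <= k * mdist x x'.

(* The inverse is carried as data; it is determined by the function. *)
Record biLipHomeo (R : realType) (X Y : metricType R) := BiLipHomeo {
  bl_fun :> continuousType X Y ;
  bl_inv : continuousType Y X ;
  bl_funK : cancel bl_fun bl_inv ;
  bl_invK : cancel bl_inv bl_fun ;
  bl_fun_lip : lipschitzMap bl_fun ;
  bl_inv_lip : lipschitzMap bl_inv }.

(* The real-valued sup is the mathematical supremum here because dil is only
   applied to Lipschitz maps, whose quotients are bounded above. *)
Definition dil (R : realType) (X Y : metricType R) (f : X -> Y) : R :=
  if `[< forall x x' : X, x = x' >] then 1
  else sup [set mdist (f x.1) (f x.2) / mdist x.1 x.2 |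
            x in [set x : X * X | x.1 <> x.2]].

Definition epsIsometry (R : realType) (X Y : metricType R) (e : R)
    (f : biLipHomeo X Y) :=
  `|ln (dil f)| + `|ln (dil (bl_inv f))| <= e.

Record pathLaw (R : realType) (T : R) := PathLaw {
  pl_space : compactMetric R ;
  pl_law : probability (pathSpace T pl_space) R }.

Section isomorphisms.
Context (R : realType) (T : R).
Implicit Types p q : pathLaw T.

Definition isomorphic p q :=
  exists2 f : continuousType (pl_space p) (pl_space q), isometry f &
    forall A : set (pathSpace T (pl_space q)), measurable A ->
      pushforward (pl_law p) (Phi f) A = pl_law q A.

Definition epsDeltaIsomorphism (e d : R) p q
    (f : biLipHomeo (pl_space p) (pl_space q)) :=
  let a := d * expR e in
  let P := pl_law p in
  let Q := pl_law q in
  epsIsometry e f /\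
  (forall A : set (pathSpace T (pl_space q)), measurable A ->
    (pushforward P (Phi f) A <= Q (enlargement A a) + a%:E)%E /\
    (Q A <= pushforward P (Phi f) (enlargement A a) + a%:E)%E) /\
  (forall B : set (pathSpace T (pl_space p)), measurable B ->
    (pushforward Q (Phi (bl_inv f)) B <= P (enlargement B a) + a%:E)%E /\
    (P B <= pushforward Q (Phi (bl_inv f)) (enlargement B a) + a%:E)%E).

Definition dLP_pair p q : \bar R :=
  ereal_inf [set r | exists e d : R, [/\ 0 <= e, 0 <= d, r = (e + d)%:E &
    exists f : biLipHomeo (pl_space p) (pl_space q),
      epsDeltaIsomorphism e d f]].

End isomorphisms.

Section isometries.
Context (R : realType) (T : R).

Lemma isometry_inverse (X Y : compactMetric R) (f : continuousType X Y) :
  isometry f -> exists g : continuousType Y X,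
    [/\ isometry g, cancel f g & cancel g f].
Proof.
move=> [fsurj fiso].
have [g gK] := choice fsurj.
have fK : cancel f g.
  by move=> x; apply: mdist_positivity; rewrite -fiso gK mdistxx.
have giso y y' : mdist (g y) (g y') = mdist y y' by rewrite -fiso !gK.
have gcts : continuous (g : Y -> X).
  move=> y A /nbhs_ballP[e /= e0 eA]; apply/nbhs_ballP; exists e => //= y' yy'.
  by apply: eA; move: yy'; rewrite !ballEmdist /= giso.
exists (mkcts gcts); split => //; split => // x.
by exists (f x); exact: fK.
Qed.

Lemma Phi_comp (X Y Z : compactMetric R) (g : continuousType Y Z)
    (f : continuousType X Y) (v : pathSpace T X) :
  Phi (g \o f : continuousType _ _) v = Phi g (Phi f v).
Proof. exact/continuousEP. Qed.

Lemma PhiK (X Y : compactMetric R) (f : continuousType X Y)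
    (g : continuousType Y X) : cancel f g ->
  cancel (@Phi R T _ _ f) (Phi g).
Proof. by move=> fK v; apply/continuousEP => t /=; exact: fK. Qed.

Lemma isometry_Phi (X Y : compactMetric R) (f : continuousType X Y)
    (v w : pathSpace T X) : isometry f ->
  mdist (Phi f v) (Phi f w) = mdist v w.
Proof.
move=> [_ fiso]; rewrite /mdist /= /dC; congr sup.
by apply: eq_imagel => t _ /=; rewrite fiso.
Qed.

Lemma isometry_enlargement (X Y : compactMetric R) (f : continuousType X Y)
    (g : continuousType Y X) (A : set (pathSpace T Y)) (a : R) :
  isometry f -> cancel f g -> cancel g f ->
  Phi f @^-1` (enlargement A a) = enlargement (Phi f @^-1` A) a.
Proof.
move=> fiso fK gK; apply/seteqP; split => v /=.
  move=> /enlargementP[w Aw vw]; apply/enlargementP; exists (Phi g w).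
    by rewrite /= PhiK.
  by rewrite -(isometry_Phi _ _ fiso) PhiK.
move=> /enlargementP[w Aw vw]; apply/enlargementP; exists (Phi f w) => //.
by rewrite isometry_Phi.
Qed.

Lemma dil_isometryr (X X' Y : metricType R) (i : X' -> X) (f : X -> Y) :
  isometry i -> dil (f \o i) = dil f.
Proof.
move=> [isurj iiso]; rewrite /dil.
have iinj x x' : i x = i x' -> x = x'.
  by move=> xx'; apply: mdist_positivity; rewrite -iiso xx' mdistxx.
have -> : `[< forall x x' : X', x = x' >] = `[< forall x x' : X, x = x' >].
  apply: asbool_equiv_eq; split => H x x'; last exact: iinj.
  by have [y <-] := isurj x; have [y' <-] := isurj x'; rewrite (H y y').
case: ifP => // _; congr sup; apply/seteqP; split => _ [[x x'] /= xx' <-].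
  by exists (i x, i x') => /=; [move=> /iinj|rewrite iiso].
have [y yE] := isurj x; have [y' yE'] := isurj x'; rewrite -yE -yE' in xx' *.
by exists (y, y') => /=; [move=> E; apply: xx'; rewrite E|rewrite iiso].
Qed.

Lemma dil_isometryl (X Y Y' : metricType R) (f : X -> Y) (j : Y -> Y') :
  isometry j -> dil (j \o f) = dil f.
Proof.
move=> [_ jiso]; rewrite /dil; case: ifP => // _; congr sup.
by apply: eq_imagel => -[x x'] _ /=; rewrite jiso.
Qed.

Definition biLipHomeo_sym (X Y : compactMetric R) (f : biLipHomeo X Y) :
    biLipHomeo Y X :=
  BiLipHomeo (bl_invK f) (bl_funK f) (bl_inv_lip f) (bl_fun_lip f).

Lemma isometry_biLipHomeo (X X' Y : compactMetric R) (i : continuousType X' X)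
    (i' : continuousType X X') (f : biLipHomeo X Y) :
  isometry i -> isometry i' -> cancel i i' -> cancel i' i ->
  exists g : biLipHomeo X' Y,
    bl_fun g = (f \o i : continuousType _ _) /\
    bl_inv g = (i' \o bl_inv f : continuousType _ _).
Proof.
move=> [_ iiso] [_ i'iso] iK i'K.
have K1 : cancel (f \o i) (i' \o bl_inv f).
  by move=> x /=; rewrite bl_funK iK.
have K2 : cancel (i' \o bl_inv f) (f \o i).
  by move=> x /=; rewrite i'K bl_invK.
have L1 : lipschitzMap (f \o i).
  by have [k Hk] := bl_fun_lip f; exists k => x x' /=; rewrite -iiso.
have L2 : lipschitzMap (i' \o bl_inv f).
  by have [k Hk] := bl_inv_lip f; exists k => x x' /=; rewrite i'iso.
by exists (@BiLipHomeo R X' Y (f \o i : continuousType _ _)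
  (i' \o bl_inv f : continuousType _ _) K1 K2 L1 L2).
Qed.

Lemma isomorphic_refl (p : pathLaw T) : isomorphic p p.
Proof.
exists (idfun : continuousType _ _).
  by split => // y; exists y.
move=> A _; rewrite /pushforward; congr (pl_law p _).
by apply/seteqP; split => v /=; rewrite (_ : Phi _ v = v)//; exact/continuousEP.
Qed.

Lemma isomorphic_sym (p q : pathLaw T) : isomorphic p q -> isomorphic q p.
Proof.
move=> [f fiso fPQ]; have [g [giso fK gK]] := isometry_inverse fiso.
exists g => // A mA; rewrite /pushforward -fPQ.
  rewrite /pushforward; congr (pl_law p _).
  by apply/seteqP; split => v /=; rewrite PhiK.
by rewrite -[X in measurable X]setTI; exact: Phi_measurable.
Qed.

Lemma isomorphic_trans (p q r : pathLaw T) :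
  isomorphic p q -> isomorphic q r -> isomorphic p r.
Proof.
move=> [f [fsurj fiso] fPQ] [g [gsurj giso] gQR].
exists (g \o f : continuousType _ _).
  split=> [z|x x' /=]; last by rewrite giso fiso.
  by have [y <-] := gsurj z; have [x <-] := fsurj y; exists x.
move=> A mA; rewrite -gQR// /pushforward -fPQ.
  rewrite /pushforward; congr (pl_law p _).
  by apply/seteqP; split => v /=; rewrite Phi_comp.
by rewrite -[X in measurable X]setTI; exact: Phi_measurable.
Qed.

Lemma dLP_pair_sym (p q : pathLaw T) : dLP_pair p q = dLP_pair q p.
Proof.
suff H (p' q' : pathLaw T) : (dLP_pair p' q' <= dLP_pair q' p')%E.
  by apply/eqP; rewrite eq_le !H.
apply: ereal_inf_le_tmp => r [e [d [e0 d0 rE [f [fe [fA fB]]]]]].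
exists e, d; split => //; exists (biLipHomeo_sym f); split; last by split.
by rewrite /epsIsometry /= addrC.
Qed.

Lemma dLP_pair_isomorphic (p p' q q' : pathLaw T) :
  isomorphic p p' -> isomorphic q q' -> dLP_pair p q = dLP_pair p' q'.
Proof.
suff H (a b c : pathLaw T) : isomorphic b a -> (dLP_pair b c <= dLP_pair a c)%E.
  have H' (a b c : pathLaw T) : isomorphic b a -> dLP_pair b c = dLP_pair a c.
    by move=> ba; apply/eqP; rewrite eq_le !H//; exact: isomorphic_sym.
  move=> pp' qq'; rewrite (H' _ _ _ pp') dLP_pair_sym (H' _ _ _ qq').
  exact: dLP_pair_sym.
move=> [i iiso iP]; have [i' [i'iso iK i'K]] := isometry_inverse iiso.
apply: ereal_inf_le_tmp => r [e [d [e0 d0 rE [f [fe [fA fB]]]]]].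
exists e, d; split => //.
have [g [gE giE]] := isometry_biLipHomeo f iiso i'iso iK i'K.
have iP' (B : set (pathSpace T (pl_space b))) : measurable B ->
    pl_law b B = pl_law a (Phi i' @^-1` B).
  move=> mB; rewrite -iP.
    rewrite /pushforward; congr (pl_law b _).
    by apply/seteqP; split => v /=; rewrite PhiK.
  by rewrite -[X in measurable X]setTI; exact: Phi_measurable.
have gP (A : set (pathSpace T (pl_space c))) : measurable A ->
    pushforward (pl_law b) (Phi g) A = pushforward (pl_law a) (Phi f) A.
  move=> mA; rewrite {2}/pushforward -iP.
    rewrite /pushforward; congr (pl_law b _).
    by apply/seteqP; split => v /=; rewrite gE Phi_comp.
  by rewrite -[X in measurable X]setTI; exact: Phi_measurable.
have gQ (B : set (pathSpace T (pl_space b))) :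
    pushforward (pl_law c) (Phi (bl_inv g)) B =
    pushforward (pl_law c) (Phi (bl_inv f)) (Phi i' @^-1` B).
  rewrite /pushforward; congr (pl_law c _).
  by apply/seteqP; split => v /=; rewrite giE Phi_comp.
exists g; split; [|split].
- rewrite /epsIsometry.
  have -> : dil g = dil f by rewrite gE; exact: dil_isometryr.
  have -> : dil (bl_inv g) = dil (bl_inv f).
    by rewrite giE; exact: dil_isometryl.
  exact: fe.
- move=> A mA; rewrite !gP//; last exact: enlargement_measurable.
  exact: fA.
- move=> B mB; rewrite !gQ !iP'//; last exact: enlargement_measurable.
  rewrite (isometry_enlargement _ _ i'iso i'K iK); apply: fB.
  by rewrite -[X in measurable X]setTI; exact: Phi_measurable.
Qed.

End isometries.

(* An element of PM is an isomorphism class, i.e. a predicate of the form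
   isomorphic p. The quotient type {eq_quot _} would need a choiceType
   structure on pathLaw, which lives in too large a universe for that. *)
Record PM (R : realType) (T : R) := MkPM {
  PM_class :> pathLaw T -> Prop ;
  PM_classP : exists p, PM_class = isomorphic p }.

Definition PM_pi (R : realType) (T : R) (p : pathLaw T) : PM T :=
  MkPM (ex_intro _ p erefl).

Definition PM_repr (R : realType) (T : R) (x : PM T) : pathLaw T :=
  projT1 (cid (PM_classP x)).

Lemma PM_eqP (R : realType) (T : R) (p q : pathLaw T) :
  PM_pi p = PM_pi q <-> isomorphic p q.
Proof.
split=> [/(congr1 (@PM_class R T)) /= ->|pq]; first exact: isomorphic_refl.
rewrite /PM_pi; have E : isomorphic p = isomorphic q.
  apply/funext => r; apply/propext; split; apply: isomorphic_trans => //.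
  exact: isomorphic_sym.
by move: (ex_intro _ p _); rewrite E => H; congr MkPM; exact: Prop_irrelevance.
Qed.

Lemma PM_reprK (R : realType) (T : R) (x : PM T) : PM_pi (PM_repr x) = x.
Proof.
rewrite /PM_repr; case: cid => p /=; case: x => c cP /= cE.
by move: cP; rewrite cE => cP; congr MkPM; exact: Prop_irrelevance.
Qed.

(* Independent of the representatives: see dLP_pi below. *)
Definition dLP (R : realType) (T : R) (x y : PM T) : \bar R :=
  dLP_pair (PM_repr x) (PM_repr y).

Lemma dLP_pi (R : realType) (T : R) (p q : pathLaw T) :
  dLP (PM_pi p) (PM_pi q) = dLP_pair p q.
Proof. by apply: dLP_pair_isomorphic; apply/PM_eqP; rewrite PM_reprK. Qed.

(* Main.v *)
(** Pass to a subsequence [X_n] with [(1/2^n)]-isometries [f_n : X_n -> X_(n+1)]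
    that move the laws by at most [1/2^n].  The compositions [F_n : X_0 -> X_n]
    distort distances by summable factors, so [d(F_n x, F_n y)] converges to a
    metric on [X_0] that is bi-Lipschitz to the original one: this is the limit
    space [Y].  Pushed to the path space of [Y], the laws form a Prokhorov-Cauchy
    sequence.

    Its limit is obtained by coupling.  The path space is separable, so each law
    is close to a uniform law on [N_n] paths, that is, to the law of a step
    function [h_n] on [[0,1)] with the grid [1/N_n]; we take [N_n | N_(n+1)].  The
    Prokhorov inequality between consecutive laws is a deficient Hall condition,
    which lets us permute the values of [h_(n+1)] so that it is close to [h_n] off a
    set of small measure.  By Borel-Cantelli and completeness of the path space
    [h_n] converges almost surely, and the law of its limit is the limit law. *)

Require Import Defs.
From HB Require Import structures.
From mathcomp Require Import all_boot all_order all_algebra all_fingroup zify.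

Set Implicit Arguments.
Unset Strict Implicit.
Unset Printing Implicit Defensive.

(** * Hall's marriage theorem, with deficiency *)

Definition nbhd (A B : finType) (E : A -> B -> bool) (I : {set A}) : {set B} :=
  [set b | [exists a in I, E a b]].

Lemma nbhdU (A B : finType) (E : A -> B -> bool) (I J : {set A}) :
  nbhd E (I :|: J) = nbhd E I :|: nbhd E J.
Proof.
apply/setP => b; rewrite !inE; apply/existsP/orP => [[a]|[] /existsP[a /andP[aI ab]]].
- by rewrite !inE => /andP[/orP[aI|aJ] ab]; [left|right]; apply/existsP; exists a;
    apply/andP.
- by exists a; rewrite !inE aI.
- by exists a; rewrite !inE aI orbT.
Qed.

(** Induction on [#|X|]. If some proper nonempty [I] is tight, with at most [#|I|] neighbours in
    [Y], then [I] and [X :\: I] are matched separately, the latter outside [nbhd E I]. Otherwise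
    every such set has a neighbour to spare, so any edge may be fixed and its two ends removed. *)
Lemma hall_marriage (A B : finType) (b0 : B) (E : A -> B -> bool)
    (X : {set A}) (Y : {set B}) :
  (forall I : {set A}, I \subset X -> #|I| <= #|nbhd E I :&: Y|) ->
  exists2 f : A -> B, {in X &, injective f} &
    forall a, a \in X -> (f a \in Y) && E a (f a).
Proof.
have [n] := ubnP #|X|; elim: n X Y => // n IHn X Y Xn hallX.
have [/eqP ->|/set0Pn[x xX]] := boolP (X == set0).
  by exists (fun=> b0) => [a b|a]; rewrite inE.
have [tight|] := boolP [exists I : {set A},
    [&& I \proper X, I != set0 & #|nbhd E I :&: Y| <= #|I|]].
  have /existsP[I /and3P[IX I0 cI]] := tight.
  have sIX := proper_sub IX.
  have cI_gt0 : 0 < #|I| by rewrite card_gt0.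
  have [||f1 f1inj f1E] := IHn I Y.
  - by have := proper_card IX; lia.
  - by move=> J JI; apply: hallX; apply: subset_trans sIX.
  have [||f2 f2inj f2E] := IHn (X :\: I) (Y :\: nbhd E I).
  - by have := cardsD X I; rewrite (setIidPr sIX); have := subset_leq_card sIX; lia.
  (* Hall's condition for [J :|: I], less the at most [#|I|] neighbours of [I], is Hall's condition
     for [J] outside [nbhd E I]. *)
  - move=> J JXI; have := hallX (J :|: I); rewrite subUset sIX (subset_trans JXI) ?subsetDl//=.
    move=> /(_ isT); rewrite nbhdU setIUl.
    have -> : #|J :|: I| = #|J| + #|I|.
      rewrite cardsU (_ : J :&: I = set0) ?cards0 ?subn0//.
      apply/setP => a; rewrite !inE; apply/negP => /andP[aJ aI].
      by have := subsetP JXI a aJ; rewrite inE aI.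
    have -> : nbhd E J :&: Y :|: nbhd E I :&: Y =
        (nbhd E J :&: (Y :\: nbhd E I)) :|: (nbhd E I :&: Y).
      by apply/setP => b; rewrite !inE; case: [exists a in I, _]; case: (b \in Y);
        case: [exists a in J, _].
    by rewrite cardsU; lia.
  exists (fun a => if a \in I then f1 a else f2 a) => [a b aX bX|a aX].
    have mI c : c \in I -> f1 c \in nbhd E I.
      by move=> cI'; rewrite inE; apply/existsP; exists c; case/andP: (f1E c cI') => _ ->;
        rewrite cI'.
    have nI c : c \in X -> c \notin I -> f2 c \notin nbhd E I.
      move=> cX cI'; have := f2E c; rewrite in_setD cX cI' => /(_ isT).
      by rewrite in_setD => /andP[/andP[]].
    case: ifPn => aI; case: ifPn => bI.
    - exact: f1inj.
    - by move=> e; have := nI b bX bI; rewrite -e mI.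
    - by move=> e; have := nI a aX aI; rewrite e mI.
    - by apply: f2inj; rewrite inE ?aI ?bI.
  case: ifPn => aI; first exact: f1E.
  have := f2E a; rewrite in_setD aX aI => /(_ isT).
  by rewrite in_setD => /andP[/andP[_ ->] ->].
rewrite negb_exists => /forallP slack.
have := hallX [set x]; rewrite sub1set xX cards1 card_gt0 => /(_ isT)/set0Pn[y].
rewrite !inE => /andP[/existsP[x' /andP[/[!inE] /eqP -> xy]] yY].
have [||f finj fE] := IHn (X :\ x) (Y :\ y).
- by have := cardsD1 x X; rewrite xX; lia.
- move=> J JX; have [->|J0] := eqVneq J set0; first by rewrite cards0.
  have := slack J; rewrite J0 properEneq (subset_trans JX) ?subsetDl//= andbT andbC.
  have -> : J != X.
    by apply/eqP => JE; have := subsetP JX x; rewrite JE xX !inE eqxx => /(_ isT).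
  rewrite /= andbT -ltnNge.
  have -> : nbhd E J :&: (Y :\ y) = (nbhd E J :&: Y) :\ y.
    by apply/setP => b; rewrite !inE; case: (b == y); rewrite ?andbF.
  by have := cardsD1 y (nbhd E J :&: Y); case: (y \in _); lia.
exists (fun a => if a == x then y else f a) => [a b aX bX|a aX].
  case: eqP => [->|/eqP ax]; case: eqP => [->//|/eqP bx].
  - by move=> e; have := fE b; rewrite !inE bx bX -e eqxx => /(_ isT).
  - by move=> e; have := fE a; rewrite !inE ax aX e eqxx => /(_ isT).
  - by apply: finj; rewrite !inE ?ax ?bx.
case: eqP => [->|/eqP ax]; first by rewrite yY xy.
by have := fE a; rewrite !inE ax aX => /(_ isT) /andP[/andP[_ ->]].
Qed.

(** A permutation [s] that agrees with [g] on [D :\ x] is corrected at [x] by the transposition of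
    [s x] and [g x]; injectivity of [s] and [g] keeps the other values on [D] fixed. *)
Lemma perm_extension (A : finType) (D : {set A}) (g : A -> A) :
  {in D &, injective g} -> exists s : {perm A}, {in D, s =1 g}.
Proof.
have [n] := ubnP #|D|; elim: n D => // n IHn D Dn ginj.
have [->|/set0Pn[x xD]] := eqVneq D set0; first by exists 1%g => a; rewrite inE.
have [||s sE] := IHn (D :\ x).
- by have := cardsD1 x D; rewrite xD; lia.
- by move=> a b /setD1P[_ aD] /setD1P[_ bD]; exact: ginj.
exists (s * tperm (s x) (g x))%g => a aD; rewrite permM.
have [->|ax] := eqVneq a x; first by rewrite tpermL.
have sa : s a = g a by rewrite sE// !inE ax.
rewrite tpermD//; first by rewrite (inj_eq perm_inj) eq_sym.
by rewrite sa; apply: contra_neq ax => /ginj ->.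
Qed.

(* Hall's theorem after adding [k] elements adjacent to everything. *)
Lemma hall_deficiency (A : finType) (E : rel A) (k : nat) :
  (forall I : {set A}, #|I| <= #|nbhd E I| + k) ->
  exists s : {perm A}, #|[set a | ~~ E a (s a)]| <= k.
Proof.
move=> hallA; case: (posnP #|A|) => [A0|/card_gt0P[a0 _]].
  exists 1%g; rewrite (_ : [set _ | _] = set0) ?cards0//.
  by apply/setP => a; have := fintype0 a A0.
pose F (a : A) (b : A + 'I_k) := if b is inl b then E a b else true.
have [I _|f finj fE] := @hall_marriage A _ (inl a0 : A + 'I_k)%type F [set: A] setT.
  rewrite setIT; have [->|/set0Pn[a aI]] := eqVneq I set0; first by rewrite cards0.
  have -> : nbhd F I = (inl @: nbhd E I) :|: (inr @: [set: 'I_k]).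
    apply/setP => -[b|j]; rewrite !inE.
      rewrite mem_imset; last by move=> ? ? [].
      rewrite (_ : inl b \in inr @: _ = false) ?orbF ?inE//.
      by apply/imsetP => -[].
    rewrite [inr j \in inr @: _]mem_imset ?inE ?orbT; last by move=> ? ? [].
    by apply/existsP; exists a; rewrite aI.
  rewrite cardsU (_ : _ :&: _ = set0) ?cards0 ?subn0; last first.
    by apply/setP => b; rewrite !inE; apply/negP => /andP[/imsetP[? _ ->] /imsetP[]].
  rewrite !card_imset; try by move=> ? ? [].
  by rewrite cardsT card_ord.
(* [D] holds the elements matched inside [A]. The others go injectively to the [k] extra elements,
   so there are at most [k] of them. *)
pose D := [set a | if f a is inl _ then true else false].
pose g a := if f a is inl b then b else a.
have [|s sE] := @perm_extension A D g.
  move=> a b; rewrite !inE /g => aD bD ab; apply: (finj a b); rewrite ?inE//.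
  by case: (f a) (f b) aD bD ab => [?|?] [?|?] // _ _ ->.
exists s; apply: (@leq_trans #|~: D|).
  apply: subset_leq_card; apply/subsetP => a; rewrite !inE; apply: contra => aD.
  have /sE -> : a \in D by rewrite inE.
  by have := fE a; rewrite inE /g => /(_ isT); rewrite inE; case: (f a) aD.
have -> : #|~: D| = #|f @: ~: D|.
  by rewrite card_in_imset// => a b _ _; apply: finj; rewrite inE.
rewrite -[X in _ <= X]card_ord -cardsT -[X in _ <= X](@card_imset _ (A + 'I_k)%type inr); last by move=> ? ? [].
apply: subset_leq_card; apply/subsetP => _ /imsetP[a aD ->]; move: aD; rewrite !inE.
by case: (f a) => // j _; apply: imset_f.
Qed.

From mathcomp Require Import all_classical all_reals all_analysis.
From mathcomp Require Import measurable_realfun ring lra.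
Import Order.TTheory GRing.Theory Num.Theory.
Import numFieldNormedType.Exports.

Local Open Scope classical_set_scope.
Local Open Scope ring_scope.

(** * Enlargements and the one-sided Prokhorov inequality *)

Section enlargement.
Context (R : realType) (M : metricType R).
Implicit Types (A B : set M) (a b : R).

Lemma enlargementS A B a b : A `<=` B -> a <= b ->
  enlargement A a `<=` enlargement B b.
Proof.
move=> AB ab x /enlargementP[y /AB By xy]; apply/enlargementP; exists y => //.
exact: lt_le_trans ab.
Qed.

Lemma enlargementD A a b :
  enlargement (enlargement A a) b `<=` enlargement A (a + b).
Proof.
move=> x /enlargementP[y /enlargementP[z Az yz] xy]; apply/enlargementP; exists z => //.
by rewrite (le_lt_trans (metric_triangle _ y _))// addrC ltrD.
Qed.

Lemma sub_enlargement A a : 0 < a -> A `<=` enlargement A a.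
Proof. by move=> a0 x Ax; apply/enlargementP; exists x; rewrite ?mdistxx. Qed.

End enlargement.

Section pushforward_probability.
Context d d' (T : measurableType d) (T' : measurableType d') (R : realType).
Variables (P : probability T R) (f : T -> T').
Hypothesis mf : measurable_fun setT f.

HB.instance Definition _ := isMeasurableFun.Build _ _ _ _ f mf.

Definition image_law : probability T' R := distribution P (f : {mfun T >-> T'}).

Lemma image_lawE A : image_law A = P (f @^-1` A).
Proof. by []. Qed.

End pushforward_probability.

Section prokhorov.
Context (R : realType) (T : R) (X : compactMetric R).
Implicit Types (P Q W : probability (pathSpace T X) R) (e : R).

(* One inequality suffices: see [prokhorov_le_sym]. *)
Definition prokhorov_le P Q e := forall A : set (pathSpace T X), measurable A ->
  (P A <= Q (enlargement A e) + e%:E)%E.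

(** A point within [e] of the complement of [enlargement A e] cannot lie in [A]. So the hypothesis
    is applied to that complement, and complements are taken. *)
Lemma prokhorov_le_sym P Q e : prokhorov_le P Q e -> prokhorov_le Q P e.
Proof.
move=> PQ A mA; have mAe : measurable (enlargement A e) by exact: enlargement_measurable.
have := PQ _ (measurableC mAe).
have mB : measurable (enlargement (~` enlargement A e) e) by exact: enlargement_measurable.
have : (Q (enlargement (~` enlargement A e) e) <= Q (~` A))%E.
  apply: le_measure; rewrite ?inE//; first exact: measurableC.
  move=> v /enlargementP[w wA vw] Av; apply: wA; apply/enlargementP; exists v => //.
  by rewrite metric_sym.
rewrite !probability_setC//.
have /fineK <- := fin_num_measure P _ mAe; have /fineK <- := fin_num_measure Q _ mA.
have /fineK <- := fin_num_measure Q _ mB.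
by rewrite -!EFinB -!EFinD !lee_fin; lra.
Qed.

Lemma prokhorov_le_trans P Q W e e' :
  prokhorov_le P Q e -> prokhorov_le Q W e' -> prokhorov_le P W (e + e').
Proof.
move=> PQ QW A mA; apply: le_trans (PQ A mA) _.
rewrite EFinD (addeC e%:E) addeA; apply: leeD => //.
apply: le_trans (QW _ (enlargement_measurable A e)) _.
apply: leeD => //; apply: le_measure; rewrite ?inE; try exact: enlargement_measurable.
exact: enlargementD.
Qed.

Lemma prokhorov_leW P Q e e' : e <= e' -> prokhorov_le P Q e -> prokhorov_le P Q e'.
Proof.
move=> ee' PQ A mA; apply: le_trans (PQ A mA) _.
rewrite leeD ?lee_fin//; apply: le_measure; rewrite ?inE; try exact: enlargement_measurable.
exact: enlargementS.
Qed.

End prokhorov.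

(** * Step functions on the unit interval *)

Section uniform01.
Context (R : realType).

Definition uniform01 := mrestr (@lebesgue_measure R) (measurable_itv `[0, 1[).

HB.instance Definition _ := Measure.on uniform01.

Lemma uniform01_setT : uniform01 setT = 1%E.
Proof.
rewrite /uniform01 /mrestr setTI lebesgue_measure_itv/= lte_fin ltr01.
by rewrite -EFinB subr0.
Qed.

HB.instance Definition _ := Measure_isProbability.Build _ _ _ uniform01 uniform01_setT.

(** For [N > 0] the value is [x i] on the cell [[i / N, (i + 1) / N[]. At negative [t] the
    truncation is [0], which makes the function total; [uniform01] is carried by [[0, 1[]. *)
Definition step (S : Type) (N : nat) (x : nat -> S) (t : R) : S := x (Num.truncn (N%:R * t)).

(** Any set of indices will do: the preimage is a countable union of level sets, each a difference
    of sublevel sets. *)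
Lemma measurable_truncn_preimage (N : nat) (a : set nat) :
  measurable [set t : R | a (Num.truncn (N%:R * t))].
Proof.
have mle k : measurable [set t : R | (Num.truncn (N%:R * t) <= k)%N].
  have mN : measurable_fun setT (fun t : R => N%:R * t) by exact: mulrl_measurable.
  rewrite (_ : [set _ | _] = setT `&` (fun t : R => N%:R * t) @^-1` `]-oo, k.+1%:R[).
    exact: mN.
  by rewrite setTI; apply/seteqP; split => t /=; rewrite in_itv/= truncn_le_nat.
have meq k : measurable [set t : R | Num.truncn (N%:R * t) = k].
  case: k => [|k].
    rewrite (_ : [set _ | _] = [set t : R | (Num.truncn (N%:R * t) <= 0)%N])//.
    by apply/seteqP; split => t /=; rewrite leqn0 => /eqP.
  rewrite (_ : [set _ | _] = [set t : R | (Num.truncn (N%:R * t) <= k.+1)%N] `\`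
      [set t : R | (Num.truncn (N%:R * t) <= k)%N]); first exact: measurableD.
  apply/seteqP; split => t /=; first by move=> ->; rewrite leqnn ltnn.
  by move=> [t1 /negP]; rewrite -ltnNge => t2; apply/eqP; rewrite eqn_leq t1.
rewrite (_ : [set _ | _] = \bigcup_(k in a) [set t : R | Num.truncn (N%:R * t) = k]).
  by apply: bigcup_measurable.
by apply/seteqP; split => [t at_|t [k ak /= ->]//]; exists (Num.truncn (N%:R * t)).
Qed.

Lemma uniform01_truncn (N : nat) (a : pred nat) : (0 < N)%N ->
  uniform01 [set t | a (Num.truncn (N%:R * t))] =
  (#|[set i : 'I_N | a i]%SET|%:R / N%:R)%:E.
Proof.
move=> N0; have N0' : 0 < N%:R :> R by rewrite ltr0n.
pose J (i : 'I_N) : set R := `[i%:R / N%:R, i.+1%:R / N%:R[%classic.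
have JE i t : J i t <-> 0 <= t /\ Num.truncn (N%:R * t) = i.
  rewrite /J /= in_itv/= ler_pdivrMr// ltr_pdivlMr// mulrC; split.
    move=> H; split; last exact: truncn_def.
    by rewrite -(pmulr_rge0 _ N0') (le_trans _ (andP H).1).
  by move=> [t0 <-]; apply: truncn_itv; rewrite mulr_ge0// ltW.
rewrite /uniform01 /mrestr.
rewrite (_ : _ `&` _ = \big[setU/set0]_(i < N | a i) J i); last first.
  rewrite -bigcup_seq_cond; apply/seteqP; split => t /=.
    rewrite in_itv/= => -[at_ /andP[t0 t1]].
    have tN : (Num.truncn (N%:R * t) < N)%N.
      by rewrite truncn_lt_nat ?mulr_ge0// ?ltW// gtr_pMr.
    by exists (Ordinal tN); [rewrite /= mem_index_enum|exact/JE].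
  move=> [i /= /andP[_ ai] /JE[t0 ti]]; rewrite ti; split => //.
  rewrite in_itv/= t0/= -(ltr_pM2l N0') mulr1 -truncn_lt_nat ?ti//.
  by rewrite mulr_ge0// ltW.
rewrite measure_bigsetU_ord.
- rewrite (eq_bigr (fun=> (N%:R^-1)%:E)) => [|i _]; last first.
    transitivity (lebesgue_measure (J i)) => //.
    rewrite /J lebesgue_measure_itv/= lte_fin ltr_pM2r ?invr_gt0// ltr_nat ltnSn.
    by rewrite -EFinB -mulrBl -natrB// subSnn mul1r.
  rewrite sumEFin sumr_const -(mulr_natl N%:R^-1); congr (_%:R / _)%:E.
  by apply: eq_card => i; rewrite inE.
- by move=> i; exact: measurable_itv.
- by move=> i j _ _ [t [/JE[_ ti] /JE[_]]]; rewrite ti => /val_inj.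
Qed.

Lemma measurable_step d (S : measurableType d) N (x : nat -> S) :
  measurable_fun setT (step N x).
Proof.
move=> _ A _; rewrite setTI; exact: (measurable_truncn_preimage N [set k | A (x k)]).
Qed.

End uniform01.

Arguments uniform01 : clear implicits.

(** * Matching of step laws, and approximation by step laws *)

Section matching.
Context (R : realType) (T : R) (X : compactMetric R).
Notation S := (pathSpace T X).

Definition step_law (N : nat) (x : nat -> S) : probability S R :=
  image_law (uniform01 R) (measurable_step N x).

Lemma step_lawE (N : nat) (x : nat -> S) (A : set S) : (0 < N)%N ->
  step_law N x A = (#|[set i : 'I_N | `[< A (x i) >]]%SET|%:R / N%:R)%:E.
Proof.
move=> N0; rewrite -(uniform01_truncn _ (fun k => `[< A (x k) >]) N0) /step_law image_lawE.
by congr (uniform01 R _); apply/seteqP; split => t /=; rewrite asboolE.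
Qed.

(** Permuting the values of [y] keeps its step law. Join [i] to [j] when [x i] and [y j] are less
    than [2 e] apart: the Prokhorov inequality gives Hall's condition with deficiency [e * N], and
    the badly matched cells have total mass at most [e]. *)
Lemma step_matching (N : nat) (x y : nat -> S) (e : R) : (0 < N)%N -> 0 < e ->
  prokhorov_le (step_law N x) (step_law N y) e ->
  exists2 z : nat -> S, step_law N z = step_law N y :> (set S -> \bar R) &
    (uniform01 R [set t | (e *+ 2 <= mdist (step N x t) (step N z t))%R] <= e%:E)%E.
Proof.
move=> N0 e0 xy; have N0' : 0 < N%:R :> R by rewrite ltr0n.
pose E (i j : 'I_N) := mdist (x i) (y j) < e *+ 2.
have eN : 0 <= e * N%:R by rewrite mulr_ge0// ltW.
have [|s sE] := @hall_deficiency _ E (Num.truncn (e * N%:R)).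
  (* The finite set of values is first enlarged by [e], which makes it open and hence measurable;
     the Prokhorov inequality enlarges it once more, whence the radius [e *+ 2] in [E]. *)
  move=> I; pose A : set S := enlargement [set x i | i in [set i | i \in I]] e.
  have := xy A (enlargement_measurable _ _); rewrite !step_lawE// -EFinD lee_fin.
  rewrite ler_pdivrMr// mulrDl mulfVK ?gt_eqF// => H.
  rewrite -leq_subLR truncn_ge_nat//.
  have [cI|/ltnW cI] := leqP #|I| #|nbhd E I|.
    by move: (cI); rewrite -subn_eq0 => /eqP ->.
  rewrite natrB// lerBlDl; apply: le_trans (le_trans H _).
    rewrite ler_nat; apply: subset_leq_card; apply/fintype.subsetP => i iI; rewrite inE.
    by apply/asboolP; apply: sub_enlargement => //; exists i.
  rewrite lerD2r ler_nat; apply: subset_leq_card; apply/fintype.subsetP => j; rewrite inE.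
  move=> /asboolP/enlargementP[v /enlargementP[_ [i /= iI <-] vi] jv].
  rewrite inE; apply/existsP; exists i; rewrite iI /E /= metric_sym.
  by rewrite (le_lt_trans (metric_triangle _ v _))// mulr2n ltrD.
pose z k := if insub k is Some i then y (s (i : 'I_N)) else y k.
have zE (i : 'I_N) : z i = y (s i) by rewrite /z valK.
exists z.
  apply/funext => A; rewrite !step_lawE//; congr (_%:R / _)%:E.
  rewrite -(card_preimset [set i : 'I_N | `[< A (y i) >]]%SET (@perm_inj _ s)).
  by apply: eq_card => i; rewrite !inE zE.
have := uniform01_truncn R (fun k => e *+ 2 <= mdist (x k) (z k)) N0.
rewrite /step => ->; rewrite lee_fin ler_pdivrMr//.
apply: (@le_trans _ _ (Num.truncn (e * N%:R))%:R); last by rewrite truncn_le.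
rewrite ler_nat (leq_trans _ sE)//; apply: subset_leq_card.
by apply/fintype.subsetP => i; rewrite !inE zE /E -leNgt.
Qed.

End matching.

Lemma card_nth_count (A : Type) (x0 : A) (a : pred A) (s : seq A) :
  #|[set j : 'I_(size s) | a (nth x0 s j)]%SET| = count a s.
Proof. by rewrite cardsE -sum1_card -sum1_count (big_nth x0) big_mkord. Qed.

(** Finitely many disjoint cells [C i], each within [e] of [w i], carry all but [e] of the mass.
    Each [w i] is repeated in proportion to the mass of its cell, and rounding costs another [e].
    Taking a multiple of [N0] points keeps successive grids nested. *)
Lemma discretization (R : realType) (T : R) (X : compactMetric R)
    (P : probability (pathSpace T X) R) (w : nat -> pathSpace T X) (e : R) (N0 : nat) :
  0 < e -> (0 < N0)%N -> (forall v, exists i, mdist v (w i) < e) ->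
  exists M x, (0 < M)%N /\ prokhorov_le P (step_law (N0 * M) x) (e *+ 2).
Proof.
move=> e0 N00 dense_w.
pose U i : set (pathSpace T X) := enlargement [set w i] e.
have mU i : measurable (U i) by exact: enlargement_measurable.
have UT : \bigcup_i U i = setT.
  rewrite -subTset => v _; have [i vi] := dense_w v.
  by exists i => //; apply/enlargementP; exists (w i).
pose C := seqDU U.
have mC i : measurable (C i).
  by apply: measurableD => //; apply: bigsetU_measurable => j _; exact: mU.
have [m Pm] : exists m, ((1 - e)%:E <= P (\big[setU/set0]_(i < m) C i))%E.
  have mUU m : measurable (\big[setU/set0]_(i < m) U i).
    by apply: bigsetU_measurable => j _; exact: mU.
  have Ucvg : P (\big[setU/set0]_(i < m.+1) U i) @[m --> \oo] --> 1%E.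
    rewrite -(probability_setT P) -UT -bigcup_bigsetU_bigcup.
    apply: nondecreasing_cvg_mu => //; first by apply: bigcup_measurable.
    by apply/nondecreasing_seqP => n; rewrite [leRHS]big_ord_recr/=; apply/subsetPset; exact: subsetUl.
  have [//|noM] := pselect (exists m, ((1 - e)%:E <= P (\big[setU/set0]_(i < m) C i))%E).
  have : (1 <= (1 - e)%:E)%E.
    apply: cvge_le Ucvg; apply: nearW => m; rewrite bigsetU_seqDU leNgt.
    by apply/negP => /ltW Pm; apply: noM; exists m.+1.
  by rewrite lee_fin lerBrDr gerDl leNgt e0.
pose p i := fine (P (C i)).
have PC i : P (C i) = (p i)%:E by rewrite /p fineK// fin_num_measure.
have p0 i : 0 <= p i by rewrite -lee_fin -PC.
(* Each of the [m] multiplicities loses at most one point by rounding down; this [M] gives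
   [m <= e * N]. *)
pose M := (Num.truncn (m%:R / e)).+1; pose N := (N0 * M)%N.
have N_gt0 : (0 < N)%N by rewrite muln_gt0 N00.
have N0' : 0 < N%:R :> R by rewrite ltr0n.
have mN : m%:R <= e * N%:R.
  rewrite mulrC -ler_pdivrMr// (le_trans (ltW (truncnS_gt _)))// ler_nat.
  by rewrite /N leq_pmull.
pose k i := Num.truncn (N%:R * p i).
have Np0 i : 0 <= N%:R * p i by rewrite mulr_ge0// ltW.
pose s := flatten [seq nseq (k i) (w i) | i <- iota 0 m].
have sumE (B : {pred 'I_m}) : P (\big[setU/set0]_(i < m | B i) C i) =
    (\sum_(i < m | B i) p i)%:E.
  rewrite measure_bigsetU_ord//; last first.
    move=> i j _ _ [v [Civ Cjv]]; apply/val_inj.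
    by apply: (trivIset_seqDU U) => //; exists v.
  by rewrite -sumEFin; apply: eq_bigr => i _; exact: PC.
have sN : (size s <= N)%N.
  rewrite size_flatten /shape -map_comp sumnE big_map.
  rewrite -(ler_nat R) natr_sum -{1}(subn0 m) -/(index_iota 0 m) big_mkord.
  apply: (@le_trans _ _ (\sum_(i < m) N%:R * p i)).
    by apply: ler_sum => i _; rewrite /= size_nseq truncn_le.
  rewrite -mulr_sumr ler_piMr//.
  rewrite -lee_fin -(sumE xpredT); apply: probability_le1.
  by apply: bigsetU_measurable => j _; exact: mC.
(* Padding to length [N] can only increase the count of points in [D]. *)
pose s' := s ++ nseq (N - size s) (w 0).
have s'N : size s' = N by rewrite size_cat size_nseq subnKC.
exists M, (nth (w 0) s'); split => // A mA.
rewrite step_lawE//; set D := enlargement A (e *+ 2).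
have -> : #|[set i : 'I_(N0 * M) | `[< D (nth (w 0) s' i) >]]%SET| = count (fun v => `[< D v >]) s'.
  by rewrite -(card_nth_count (w 0) (fun v => `[< D v >])) s'N.
(* If the cell [C i] meets [A], then [w i] lies in [D] and all its copies are counted. *)
pose B (i : 'I_m) := `[< A `&` C i !=set0 >].
have PA : (P A <= (\sum_(i < m | B i) p i)%:E + e%:E)%E.
  have mCC (Q : {pred 'I_m}) : measurable (\big[setU/set0]_(i < m | Q i) C i).
    by apply: bigsetU_measurable => j _; exact: mC.
  apply: (@le_trans _ _ (P (\big[setU/set0]_(i < m | B i) C i `|`
      ~` \big[setU/set0]_(i < m) C i))).
    apply: le_measure; rewrite ?inE//.
      by apply: measurableU => //; exact: measurableC.
    move=> v Av; have [] := pselect ((\big[setU/set0]_(i < m) C i) v); last by right.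
    rewrite -bigcup_seq => -[i _ Civ]; left; rewrite -bigcup_seq_cond.
    by exists i => //=; rewrite mem_index_enum; apply/asboolP; exists v.
  have PU (V W : set (pathSpace T X)) : measurable V -> measurable W ->
    (P (V `|` W) <= P V + P W)%E by exact: measureU2.
  apply: le_trans (PU _ _ (mCC _) (measurableC (mCC xpredT))) _.
  rewrite sumE leeD2l// probability_setC// lee_subel_addl//.
  by rewrite -leeBlDr// -EFinB.
apply: le_trans PA _; rewrite -!EFinD lee_fin mulr2n addrA lerD2r.
rewrite -(ler_pM2r N0') !mulrDl mulfVK ?gt_eqF//.
apply: (@le_trans _ _ (\sum_(i < m | B i) ((k i)%:R + 1))).
  rewrite mulr_suml; apply: ler_sum => i _; rewrite mulrC natr1.
  by apply/ltW/truncnS_gt.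
rewrite big_split /=; apply: lerD; last first.
  apply: le_trans mN; rewrite sumr_const ler_nat.
  by rewrite -[X in (_ <= X)%N]card_ord max_card.
rewrite -natr_sum ler_nat count_cat; apply: leq_trans (leq_addr _ _).
rewrite count_flatten -map_comp sumnE big_map.
have -> : iota 0 m = index_iota 0 m by rewrite /index_iota subn0.
rewrite big_mkord.
rewrite big_mkcond; apply: leq_sum => i _ /=; rewrite count_nseq.
case: ifPn => // /asboolP[v [Av [/enlargementP[_ -> vw] _]]].
rewrite asboolT ?mul1n//; apply/enlargementP; exists v => //.
by rewrite metric_sym (lt_le_trans vw)// mulr2n lerDl ltW.
Qed.

(** * Paths in a compact space *)

Section path_space_topology.
Context (R : realType).

(** Any cluster point works: terms [x m] with [m >= n] come arbitrarily close to it, and each is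
    within [r n] of [x n]. *)
Lemma compact_cauchy_limit (X : compactMetric R) (x : nat -> X) (r : nat -> R) :
  (forall n m, (n <= m)%N -> mdist (x n) (x m) <= r n) ->
  exists y, forall n, mdist (x n) y <= r n.
Proof.
move=> xr; have [|y [_ yx]] := @cm_compact _ X (x @ \oo) _; first exact: filterT.
exists y => n; apply/ler_addgt0Pr => e e0.
have xn : (x @ \oo) [set z | exists2 m, (n <= m)%N & z = x m].
  by exists n => // m /= nm; exists m.
have [_ [[m nm ->]]] := yx _ _ xn (nbhsx_ballx y e e0).
rewrite ballEmdist /= => ym; apply: le_trans (metric_triangle _ (x m) _) _.
by rewrite lerD ?xr// metric_sym ltW.
Qed.

(** Compactness is used in near-covering form with the filter [F] of properties that hold for all
    large enough finite lists; one list then serves every point. *)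
Lemma compact_countable_net (X : compactMetric R) (e : R) : 0 < e ->
  exists c : nat -> X, forall x, exists i, mdist x (c i) < e.
Proof.
move=> e0; have [x0 _] := cm_nonempty X.
have /compact_near_coveringP cX := @cm_compact _ X.
pose F : set_system (seq X) := [set U | exists l : seq X, forall l' : seq X, {subset l <= l'} -> U l'].
have FF : Filter F.
  split=> [|U V [l lU] [l' lV]|U V UV [l lU]]; first by exists [::].
  - exists (l ++ l') => k lk; split; [apply: lU|apply: lV] => z zl; apply: lk;
      by rewrite mem_cat zl ?orbT.
  - by exists l => l' /lU /UV.
have [|l lP] := cX _ F (fun l x => exists2 y, y \in l & mdist x y < e) FF _.
  move=> x _; exists (ball x e, [set l : seq X | x \in l]) => /=.
    by split; [exact: nbhsx_ballx|exists [:: x] => l; apply; rewrite mem_head].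
  move=> [y l] /= [xy xl]; exists x => //; move: xy.
  by rewrite ballEmdist /= metric_sym.
exists (nth x0 l) => x; have [//|y yl xy] := lP l _ x I.
by exists (index y l); rewrite nth_index.
Qed.

Context (T : R).

(** Heine's theorem. The covering argument runs over real [t] in the interval, and [set_val s = t]
    ties [t] to the subtype on which paths are defined. *)
Lemma path_equicontinuous (X : compactMetric R) (v : pathSpace T X) (e : R) : 0 < e ->
  exists m, forall s s' : set_type `[0, T],
    `|set_val s - set_val s'| < m.+1%:R^-1 -> mdist (v s) (v s') < e.
Proof.
move=> e0; have /compact_near_coveringP cT := @segment_compact R 0 T.
have [|m _ Hm] := cT nat \oo (fun m t => forall s s' : set_type `[0, T],
    set_val s = t -> `|t - set_val s'| < m.+1%:R^-1 -> mdist (v s) (v s') < e) _.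
  move=> t tT; have tT' : t \in `[0, T]%classic by rewrite inE.
  pose s0 : set_type `[0, T] := exist _ t tT'.
  have e20 : 0 < e / 2 by rewrite divr_gt0.
  have := @cts_fun _ _ v s0 _ (nbhsx_ballx (v s0) _ e20).
  move=> /nbhs_ballP[r /= r0 Hr].
  have r20 : 0 < r / 2 by rewrite divr_gt0.
  exists (ball t (r / 2), [set m | m.+1%:R^-1 < r / 2]) => /=.
    by split; [exact: nbhsx_ballx|exact: near_infty_natSinv_lt (PosNum r20)].
  move=> [t' m] /= [tt' mr] s s' st' ss'.
  have near_s (u : set_type `[0, T]) : `|t - set_val u| < r -> mdist (v s0) (v u) < e / 2.
    by move=> tu; have := Hr u tu; rewrite /= ballEmdist.
  have vs : mdist (v s0) (v s) < e / 2.
    by apply: near_s; rewrite st' (lt_trans tt')// ltr_pdivrMr// ltr_pMr// ltr1n.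
  have vs' : mdist (v s0) (v s') < e / 2.
    apply: near_s; rewrite (le_lt_trans (ler_distD t' _ _))//.
    by rewrite (splitr r) ltrD// (lt_trans ss').
  rewrite (le_lt_trans (metric_triangle _ (v s0) _))//.
  by rewrite (splitr e) ltrD// metric_sym.
exists m => s s' ss'; apply: (Hm m) ss' => //=.
by have := valP s; rewrite inE.
Qed.

Lemma interval_net (m : nat) : 0 < T -> exists k (g : nat -> set_type `[0, T]),
  forall s : set_type `[0, T], exists2 i, (i < k)%N &
    `|set_val s - set_val (g i)| < m.+1%:R^-1.
Proof.
move=> T0; pose M := (Num.truncn (T * m.+1%:R)).+1.
have M0 : 0 < M%:R :> R by rewrite ltr0n.
have TM : T / M%:R < m.+1%:R^-1.
  by rewrite ltr_pdivrMr// mulrC ltr_pdivlMr// truncnS_gt.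
have T0T : 0 \in `[0, T]%classic by rewrite inE /= in_itv/= lexx ltW.
pose g i : set_type `[0, T] := insubd (exist _ 0 T0T) (i%:R * (T / M%:R)).
(* The points [i * (T / M)] with [i <= M] include both ends of the interval, hence [M.+1] of
   them. *)
exists M.+1, g => s; have /set_mem := valP s; rewrite /= in_itv/= => /andP[s0 sT].
pose i := Num.truncn (set_val s / (T / M%:R)).
have TM0 : 0 < T / M%:R by rewrite divr_gt0.
have /andP[i1 i2] : i%:R <= set_val s / (T / M%:R) < i.+1%:R.
  by apply: truncn_itv; rewrite divr_ge0// ltW.
rewrite ler_pdivlMr// in i1; rewrite ltr_pdivrMr// in i2.
have iM : (i <= M)%N.
  rewrite -(ler_nat R) -(ler_pM2r TM0) (le_trans i1)// (le_trans sT)//.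
  by rewrite mulrC divfK// gt_eqF.
exists i => //.
have -> : set_val (g i) = i%:R * (T / M%:R).
  rewrite set_valE /g val_insubd ifT// inE /= in_itv/= (le_trans i1 sT) andbT.
  by rewrite mulr_ge0// ltW.
rewrite ger0_norm ?subr_ge0// (le_lt_trans _ TM)// lerBlDl.
by apply/ltW; rewrite (lt_le_trans i2)// -natr1 mulrDl mul1r addrC.
Qed.

(** A code records a scale of continuity for [e / 5] and, at each grid point of that scale, a net
    point within [e / 5]. There are countably many codes, and two paths sharing one differ by at
    most four times [e / 5]; [w] picks a path for each code that has one. *)
Lemma path_separable (X : compactMetric R) (e : R) : 0 < T -> 0 < e ->
  exists w : nat -> pathSpace T X, forall v, exists i, mdist v (w i) < e.
Proof.
move=> T0 e0; have e50 : 0 < e / 5 by rewrite divr_gt0.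
have [c cX] := compact_countable_net X e50.
have /choice[k /choice[g gP]] := fun m => interval_net m T0.
pose code (q : nat * seq nat) (v : pathSpace T X) :=
  (forall s s' : set_type `[0, T], `|set_val s - set_val s'| < q.1.+1%:R^-1 ->
     mdist (v s) (v s') < e / 5) /\
  (forall i, (i < k q.1)%N -> mdist (v (g q.1 i)) (c (nth 0 q.2 i)) < e / 5).
pose w n : pathSpace T X := if unpickle n is Some q then xget point [set v | code q v] else point.
exists w => v; have [m vm] := path_equicontinuous v e50.
have /choice[l lP] := fun i => cX (v (g m i)).
pose q := (m, [seq l i | i <- iota 0 (k m)]).
have qv : code q v.
  split=> //= i ik; rewrite (nth_map 0) ?size_iota// nth_iota//; exact: lP.
exists (pickle q); rewrite /w pickleK; case: xgetP => [u _ [u1 u2]|/(_ v)//].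
apply: (@le_lt_trans _ _ (e / 5 *+ 4)); last first.
  by rewrite -mulr_natr -mulrA gtr_pMr// mulrC ltr_pdivrMr// mul1r ltr_nat.
apply: dC_le => [|s]; first by rewrite mulrn_wge0// ltW.
have [i ik si] := gP m s; have [v1 v2] := qv.
apply: le_trans (metric_triangle _ (v (g m i)) _) _; rewrite mulrS lerD//.
  exact/ltW/vm.
apply: le_trans (metric_triangle _ (c (nth 0 q.2 i)) _) _; rewrite mulrS lerD//.
  exact/ltW/v2.
apply: le_trans (metric_triangle _ (u (g m i)) _) _; rewrite mulrS lerD//.
  by rewrite metric_sym; exact/ltW/u2.
by rewrite metric_sym; exact/ltW/u1.
Qed.

(** Pointwise limits exist by compactness, at the uniform rate [r], and a uniform limit of
    continuous maps is continuous. *)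
Lemma path_complete (X : compactMetric R) (v : nat -> pathSpace T X) (r : nat -> R) :
  (forall e, 0 < e -> exists n, r n < e) ->
  (forall n m, (n <= m)%N -> mdist (v n) (v m) <= r n) ->
  exists u, forall n, mdist (v n) u <= r n.
Proof.
move=> r0 vr.
have r_ge0 n : 0 <= r n by apply: le_trans (vr n n (leqnn n)); exact: mdist_ge0.
have /choice[u uP] : forall s, exists y, forall n, mdist (v n s) y <= r n.
  move=> s; apply: compact_cauchy_limit => n m nm.
  exact: le_trans (dC_ge (v n) (v m) s) (vr n m nm).
have cu : continuous (u : set_type `[0, T] -> X).
  move=> s A /nbhs_ballP[e /= e0 eA]; have e30 : 0 < e / 3 by rewrite divr_gt0.
  have [n rn] := r0 _ e30; apply/nbhs_ballP.
  have := @cts_fun _ _ (v n) s _ (nbhsx_ballx (v n s) _ e30).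
  move=> /nbhs_ballP[d /= d0 Hd]; exists d => // s' /Hd; rewrite /= ballEmdist /= => ss'.
  apply: eA; rewrite ballEmdist /=.
  rewrite (le_lt_trans (metric_triangle _ (v n s) _))//.
  have -> : e = e / 3 + (e / 3 + e / 3) by field.
  have us z : mdist (v n z) (u z) < e / 3 by exact: le_lt_trans rn.
  rewrite ltrD//; first by rewrite metric_sym.
  by rewrite (le_lt_trans (metric_triangle _ (v n s') _))// ltrD.
by exists (mkcts cu : continuousType _ _) => n; apply: dC_le.
Qed.

End path_space_topology.

(** * Limits of laws *)

(* Borel-Cantelli: off [\bigcup_(k >= n) B k] the [g k] form a Cauchy sequence. *)
Lemma limit_law (R : realType) (T : R) (X : compactMetric R) d (W : measurableType d)
    (P : probability W R) (g : nat -> W -> pathSpace T X) (r : R)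
    (mg : forall n, measurable_fun setT (g n)) : 0 < r ->
  let B n := [set t | r / 2 ^+ n <= mdist (g n t) (g n.+1 t)] in
  (forall n, measurable (B n)) -> (forall n, (P (B n) <= (r / 2 ^+ n)%:E)%E) ->
  exists Q : probability (pathSpace T X) R,
    forall n, prokhorov_le (image_law P (mg n)) Q (3 * (r / 2 ^+ n)).
Proof.
move=> r0 B mB PB; pose b n := r / 2 ^+ n.
have b0 n : 0 < b n by rewrite divr_gt0// exprn_gt0.
have bS n : b n = b n.+1 *+ 2.
  by rewrite /b exprS -mulr_natl; field; rewrite expf_neq0.
have b_small e : 0 < e -> exists n, b n *+ 2 < e.
  move=> e0; have [n] : exists n, r *+ 2 / e < 2 ^+ n.
    exists (Num.truncn (r *+ 2 / e)).+1; rewrite (lt_trans (truncnS_gt _))//.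
    by rewrite -natrX ltr_nat ltn_expl.
  rewrite ltr_pdivrMr// => H; exists n; rewrite /b -mulrnAl ltr_pdivrMr ?exprn_gt0//.
  by rewrite mulrC.
have b_noninc n m : (n <= m)%N -> b m <= b n.
  move=> /subnK <-; elim: (m - n)%N => [|k IH]; first by rewrite add0n.
  by apply: le_trans IH; rewrite [leRHS]bS -addSn mulr2n lerDl ltW.
(* The mass of [D n] is at most the geometric tail of [b] from [n] on, which is [2 * b n]. *)
pose D n := \bigcup_k B (n + k)%N.
have mD n : measurable (D n) by exact: bigcup_measurable.
have PD n : (P (D n) <= (b n *+ 2)%:E)%E.
  apply: (@le_trans _ _ (\sum_(k <oo) (b (n + k)%N)%:E)%E).
    apply: (@le_trans _ _ (\sum_(k <oo) P (B (n + k)%N))%E).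
      by apply: measure_sigma_subadditive.
    by apply: lee_nneseries => k // _; exact: PB.
  have bE k : b (n + k)%N = r *+ 2 / (2 ^ (k + n.+1))%:R.
    rewrite /b addnS addnC natrX exprS -mulr_natl; field; exact: expf_neq0.
  under eq_eseriesr do rewrite bE.
  have -> : (\sum_(k <oo) (r *+ 2 / (2 ^ (k + n.+1))%:R)%:E)%E = (r *+ 2 / 2 ^+ n)%:E.
    by apply/cvg_lim => //; exact: (@cvg_geometric_eseries_half R).
  by rewrite lee_fin /b mulrnAl.
(* A telescoping bound, since [b k = 2 * b k - 2 * b k.+1]. *)
have gE t n k m : ~ D n t -> (n <= k)%N -> (k <= m)%N ->
    mdist (g k t) (g m t) <= b k *+ 2 - b m *+ 2.
  move=> Dnt nk /subnKC <-; elim: (m - k)%N => [|j IH].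
    by rewrite addn0 mdistxx subrr.
  apply: le_trans (metric_triangle _ (g (k + j)%N t) _) _.
  have : mdist (g (k + j)%N t) (g (k + j.+1)%N t) < b (k + j)%N.
    rewrite ltNge; apply/negP => Bt; apply: Dnt; exists (k + j - n)%N => //.
    by rewrite subnKC ?(leq_trans nk) ?leq_addr// /B /= -addnS.
  have := bS (k + j)%N; rewrite -addnS; move: IH; lra.
(* On the null set where every [D n] holds, [u] is given the constant value [point]; this keeps it
   measurable. *)
have /choice[u uP] : forall t, exists u : pathSpace T X,
    (forall n k, ~ D n t -> (n <= k)%N -> mdist (g k t) u <= b k *+ 2) /\
    ((forall n, D n t) -> u = point).
  move=> t; have [H|/existsNP[n Dn]] := pselect (forall n, D n t).
    by exists point; split => // n k /(_ (H n)).
  have exD : exists n, `[< ~ D n t >] by exists n; apply/asboolP.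
  case: (ex_minnP exD) => n0 /asboolP Dn0 minn0.
  have [e /b_small[m Hm]|k m km|v Hv] := @path_complete _ T X (fun k => g (n0 + k)%N t)
    (fun k => b (n0 + k)%N *+ 2).
  - exists m; apply: le_lt_trans Hm; rewrite lerMn2r b_noninc ?orbT// leq_addl//.
  - apply: le_trans (gE t n0 _ _ Dn0 _ _) _; rewrite ?leq_addr ?leq_add2l//.
    by rewrite lerBlDr lerDl mulrn_wge0// ltW.
  - exists v; split => [n' k Dn' nk|/(_ n)//].
    have n0k : (n0 <= k)%N by apply: leq_trans nk; apply: minn0; apply/asboolP.
    by have := Hv (k - n0)%N; rewrite subnKC.
have mu : measurable_fun setT u.
  apply: (measurability (@open (pathSpace T X))) => // _ [V oV <-]; rewrite setTI.
  (* [V' k] is the set of paths at distance at least [3 * b k] from the complement of [V]. Off [D n]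
     the limit is within [2 * b k] of [g k] for [k >= n], so it lies in the open set [V] exactly
     when some such [g k] lies in [V' k]. *)
  pose V' k := ~` enlargement (~` V) (b k *+ 3).
  have mV' k : measurable (V' k) by apply: measurableC; exact: enlargement_measurable.
  rewrite (_ : u @^-1` V = (\bigcup_n \bigcup_k ((g (n + k)%N @^-1` V' (n + k)%N) `\` D n)) `|`
      ((\bigcap_n D n) `&` [set t | V point])).
    apply: measurableU.
      apply: bigcup_measurable => n _; apply: bigcup_measurable => k _.
      by apply: measurableD => //; rewrite -[X in measurable X]setTI; exact: mg.
    apply: measurableI; first exact: bigcap_measurable.
    have [H|H] := pselect (V point).
      by rewrite (_ : [set _ | _] = setT)//; apply/seteqP; split.
    by rewrite (_ : [set _ | _] = set0)//; apply/seteqP; split.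
  apply/seteqP; split => t.
    move=> /= Vut; have [H|/existsNP[n Dn]] := pselect (forall n, D n t).
      by right; split => [n _|]; [exact: H|rewrite /= -((uP t).2 H)].
    have /nbhs_ballP[e /= e0 eV] := open_nbhs_nbhs (conj oV Vut).
    have [m bm] := b_small (e / 3) (divr_gt0 e0 (ltr0n _ 3)).
    left; exists n => //; exists m => //; split=> // /enlargementP[y Vy ty]; apply: Vy.
    apply: eV; rewrite ballEmdist /=; apply: le_lt_trans (metric_triangle _ (g (n + m)%N t) _) _.
    have := (uP t).1 n (n + m)%N Dn (leq_addr _ _); rewrite metric_sym.
    have := b_noninc m (n + m)%N (leq_addl _ _).
    by rewrite ltr_pdivlMr// in bm; move: ty; lra.
  move=> [[n _ [k _ [gV Dn]]]|[H Vp]]; last by rewrite /= (uP t).2// => n; exact: H.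
  apply: contrapT => Vut; apply: gV; apply/enlargementP; exists (u t) => //.
  apply: le_lt_trans ((uP t).1 n (n + k)%N Dn (leq_addr _ _)) _.
  by have := b0 (n + k)%N; lra.
exists (image_law P mu) => n A mA.
change (P (g n @^-1` A) <= P (u @^-1` enlargement A (3 * b n)) + (3 * b n)%:E)%E.
have mf (f : W -> pathSpace T X) V : measurable_fun setT f -> measurable V ->
  measurable (f @^-1` V) by move=> mf mV; rewrite -[X in measurable X]setTI; exact: mf.
have PU V V' : measurable V -> measurable V' -> (P (V `|` V') <= P V + P V')%E.
  exact: measureU2.
have mE : measurable (u @^-1` enlargement A (3 * b n)).
  by apply: mf => //; exact: enlargement_measurable.
apply: (@le_trans _ _ (P (u @^-1` enlargement A (3 * b n) `|` D n))).
  apply: le_measure; rewrite ?inE; [exact: mf|exact: measurableU|].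
  move=> t At; have [Dn|Dn] := pselect (D n t); [by right|left].
  apply/enlargementP; exists (g n t) => //; rewrite metric_sym.
  apply: le_lt_trans ((uP t).1 n n Dn (leqnn _)) _; have := b0 n; lra.
apply: le_trans (PU _ _ mE (mD n)) _; rewrite leeD2l// (le_trans (PD n))// lee_fin.
by have := b0 n; rewrite -/(b n); lra.
Qed.

Lemma step_refine (R : realType) (S : Type) (N M : nat) (x : nat -> S) (t : R) :
  (0 < M)%N -> step (N * M) (fun i => x (i %/ M)%N) t = step N x t.
Proof.
move=> M0; rewrite /step; congr x.
have M0' : 0 < M%:R :> R by rewrite ltr0n.
have [t0|t0] := ltP t 0.
  have trunc0 (k : nat) : Num.truncn (k%:R * t) = 0%N.
    by apply/eqP; rewrite -leqn0 truncn_le_nat (le_lt_trans _ ltr01)// mulr_ge0_le0// ltW.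
  by rewrite !trunc0 div0n.
apply/esym/truncn_def; set a := Num.truncn _.
have : a%:R <= (N * M)%:R * t < a.+1%:R by apply: truncn_itv; rewrite mulr_ge0.
rewrite natrM mulrAC => /andP[a1 a2]; apply/andP; split.
  by rewrite -(ler_pM2r M0') (le_trans _ a1)// -natrM ler_nat leq_trunc_div.
by rewrite -(ltr_pM2r M0') (lt_le_trans a2)// -natrM ler_nat ltn_ceil.
Qed.

(** The relation [p] may be arbitrary because step functions take countably many values. *)
Lemma measurable_step_rel (R : realType) (S : Type) (N N' : nat) (x y : nat -> S)
    (p : S -> S -> Prop) : measurable [set t : R | p (step N x t) (step N' y t)].
Proof.
rewrite (_ : [set _ | _] = \bigcup_i ([set t : R | Num.truncn (N%:R * t) = i] `&`
    [set t : R | p (x i) (y (Num.truncn (N'%:R * t)))])).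
  apply: bigcup_measurable => i _; apply: measurableI.
    exact: (measurable_truncn_preimage N (fun k => k = i)).
  exact: (measurable_truncn_preimage N' (fun k => p (x i) (y k))).
by apply/seteqP; split => [t pt|t [i _ [/= <-]]//]; exists (Num.truncn (N%:R * t)).
Qed.

(** Step laws close to [P n] are built recursively on nested grids; [step_matching] rearranges each
    new step function so that it stays near the previous one, and [limit_law] then applies. *)
Lemma prokhorov_complete (R : realType) (T : R) (X : compactMetric R)
    (P : nat -> probability (pathSpace T X) R) (c : R) : 0 < T -> 0 < c ->
  (forall n, prokhorov_le (P n) (P n.+1) (c / 2 ^+ n)) ->
  exists Q K, 0 < K /\ forall n, prokhorov_le (P n) Q (K / 2 ^+ n).
Proof.
(* In units of [1 / 2 ^ n], consecutive step laws are within [1 + c + 1 / 2 <= c + 2]; the doubling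
   is the radius of [step_matching]. *)
move=> T0 c0 PP; pose r := (c + 2) *+ 2; have r0 : 0 < r by rewrite /r; lra.
have h0 n : 0 < (2 ^+ n)^-1 :> R by rewrite invr_gt0 exprn_gt0.
have hS n : (2 ^+ n.+1)^-1 = (2 ^+ n)^-1 / 2 :> R by rewrite exprS invfM mulrC.
pose good n (st : nat * (nat -> pathSpace T X)) :=
  (0 < st.1)%N /\ prokhorov_le (P n) (step_law st.1 st.2) (2 ^+ n)^-1.
have approx n N : (0 < N)%N -> exists M x, (0 < M)%N /\
    prokhorov_le (P n) (step_law (N * M) x) (2 ^+ n)^-1.
  move=> N0; have h1 := h0 n.+1; have [w wP] := path_separable X T0 h1.
  have [M [x [M0 Px]]] := discretization (P n) h1 N0 wP.
  exists M, x; split => //; apply: prokhorov_leW Px.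
  by rewrite hS; have := h0 n; lra.
(* Stated for all states, vacuously for those that are not [good], so that choice yields a total
   function to iterate. *)
have next (q : nat * (nat * (nat -> pathSpace T X))) : exists st', good q.1 q.2 ->
    good q.1.+1 st' /\ (uniform01 R [set t |
      (r / 2 ^+ q.1 <= mdist (step q.2.1 q.2.2 t) (step st'.1 st'.2 t))%R] <=
      (r / 2 ^+ q.1)%:E)%E.
  case: q => n [N x]; have [[/= N0 Px]|nG] := pselect (good n (N, x)); last by exists (N, x).
  have [M [y [M0 Py]]] := approx n.+1 N N0.
  have NM0 : (0 < N * M)%N by rewrite muln_gt0 N0.
  pose x' i := x (i %/ M)%N.
  have e0 : 0 < (c + 2) / 2 ^+ n by rewrite divr_gt0 ?exprn_gt0//; lra.
  have xy : prokhorov_le (step_law (N * M) x') (step_law (N * M) y) ((c + 2) / 2 ^+ n).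
    have x'E : prokhorov_le (step_law (N * M) x') (P n) (2 ^+ n)^-1.
      move=> A mA; have := prokhorov_le_sym Px mA.
      rewrite (_ : step_law N x A = step_law (N * M) x' A)//.
      by congr (uniform01 R _); apply/seteqP; split => t /=; rewrite step_refine.
    apply: prokhorov_leW (prokhorov_le_trans x'E (prokhorov_le_trans (PP n) Py)).
    by rewrite hS; have := h0 n; lra.
  have [z zE xz] := step_matching NM0 e0 xy.
  have Pz : prokhorov_le (P n.+1) (step_law (N * M) z) (2 ^+ n.+1)^-1.
    by move=> A mA; rewrite zE; exact: (Py A mA).
  exists (N * M, z)%N => _; split; first by split.
  rewrite /=; have rE : r / 2 ^+ n = (c + 2) / 2 ^+ n *+ 2 by rewrite /r mulrnAl.
  rewrite (_ : [set t | _] = [set t | ((c + 2) / 2 ^+ n *+ 2 <=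
      mdist (step (N * M) x' t) (step (N * M) z t))%R]).
    by apply: le_trans xz _; rewrite lee_fin rE mulr2n lerDl ltW.
  by rewrite -rE; apply/seteqP; split => t /=; rewrite step_refine.
have [F FP] := choice next.
have [M0 [x0 [M00 Px0]]] := approx 0%N 1%N isT.
pose st := nat_rect (fun=> nat * (nat -> pathSpace T X))%type ((1 * M0)%N, x0)
  (fun n s => F (n, s)).
have st_good n : good n (st n).
  elim: n => [|n IH]; first by split; rewrite //= mul1n.
  by have [] := FP (n, st n) IH.
pose g n (t : R) := step (st n).1 (st n).2 t.
have mg n : measurable_fun setT (g n) by exact: measurable_step.
have [n|n|Q gQ] := @limit_law R T X _ _ (uniform01 R) g r mg r0.
- exact: (measurable_step_rel _ _ _ _ (fun u v => r / 2 ^+ n <= mdist u v)).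
- by have [] := FP (n, st n) (st_good n).
exists Q, (1 + 3 * r); split=> [|n]; first lra.
rewrite mulrDl mul1r -mulrA.
exact: prokhorov_le_trans (st_good n).2 (gQ n).
Qed.

(** * Near isometries *)

Section dilatation.
Context (R : realType).

Definition lipschitz_by (X Y : metricType R) (k : R) (f : X -> Y) :=
  forall x x', mdist (f x) (f x') <= k * mdist x x'.

Lemma lipschitz_by_continuous (X Y : metricType R) (k : R) (f : X -> Y) :
  lipschitz_by k f -> continuous f.
Proof.
move=> fk x A /nbhs_ballP[e /= e0 eA]; apply/nbhs_ballP.
have k0 : 0 < `|k| + 1 by rewrite ltr_wpDl.
exists (e / (`|k| + 1)) => [|x']; first by rewrite /= divr_gt0.
rewrite ballEmdist /= ltr_pdivlMr// => xx'; apply: eA; rewrite ballEmdist /=.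
apply: le_lt_trans (fk x x') (le_lt_trans _ xx'); rewrite mulrC ler_wpM2l ?mdist_ge0//.
by rewrite (le_trans (ler_norm _))// lerDl.
Qed.

Lemma dil_lipschitz (X Y : metricType R) (f : X -> Y) :
  lipschitzMap f -> lipschitz_by (dil f) f.
Proof.
move=> [k fk] x x'; have [->|xx'] := eqVneq x x'; first by rewrite !mdistxx mulr0.
have d0 : 0 < mdist x x' by rewrite mdist_gt0.
rewrite /dil ifF; last by apply/asboolP => /(_ x x')/eqP; rewrite (negbTE xx').
rewrite -ler_pdivrMr//; apply: ub_le_sup.
  exists k => _ [[y y'] /= yy' <-]; rewrite ler_pdivrMr ?mdist_gt0//.
  exact/eqP.
by exists (x, x') => //=; exact/eqP.
Qed.

(** If [X] has two distinct points, the bound on the inverse makes their quotient at least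
    [expR (- s)], so [dil f] lies between [expR (- s)] and [expR s]. Otherwise [dil f] is [1] by
    convention. *)
Lemma normr_ln_dil (X Y : metricType R) (f : X -> Y) (g : Y -> X) (s : R) :
  0 <= s -> cancel f g -> lipschitz_by (expR s) f -> lipschitz_by (expR s) g ->
  `|ln (dil f)| <= s.
Proof.
move=> s0 fK fs gs.
have [X1|/existsNP[x /existsNP[x' xx']]] := pselect (forall x x' : X, x = x').
  by rewrite /dil asboolT// ln1 normr0.
have d0 : 0 < mdist x x' by rewrite mdist_gt0; exact/eqP.
have fd : mdist (f x) (f x') / mdist x x' <= dil f.
  by rewrite ler_pdivrMr//; apply: dil_lipschitz; exists (expR s).
have fdge : expR (- s) <= mdist (f x) (f x') / mdist x x'.
  rewrite ler_pdivlMr// expRN mulrC ler_pdivrMr ?expR_gt0// mulrC.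
  by have := gs (f x) (f x'); rewrite !fK.
have dil_le : dil f <= expR s.
  rewrite /dil ifF; last by apply/asboolP => /(_ x x').
  apply: ge_sup; first by exists (mdist (f x) (f x') / mdist x x'), (x, x').
  move=> _ [[y y'] /= yy' <-]; rewrite ler_pdivrMr ?mdist_gt0//.
  exact/eqP.
have dil_ge := le_trans fdge fd.
have dil0 : 0 < dil f by exact: lt_le_trans (expR_gt0 _) dil_ge.
by rewrite ler_norml -{1}[- s]expRK -{2}[s]expRK !ler_ln ?posrE ?expR_gt0// dil_ge.
Qed.

(** Equivalent to [epsIsometry] up to a factor [2] in the constant, but free of suprema and additive
    under composition. *)
Definition near_isometry (X Y : metricType R) (s : R) (f : biLipHomeo X Y) :=
  lipschitz_by (expR s) f /\ lipschitz_by (expR s) (bl_inv f).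

Lemma epsIsometry_near_isometry (X Y : metricType R) (s : R) (f : biLipHomeo X Y) :
  epsIsometry s f -> near_isometry s f.
Proof.
rewrite /epsIsometry => fs.
have H (Z W : metricType R) (g : Z -> W) : lipschitzMap g -> `|ln (dil g)| <= s ->
    lipschitz_by (expR s) g.
  move=> lg gs x x'; apply: le_trans (dil_lipschitz lg _ _) _.
  rewrite ler_wpM2r ?mdist_ge0//; have [d0|d0] := ltP 0 (dil g).
    by rewrite -[dil g]lnK// ler_expR; apply: le_trans (ler_norm _) gs.
  exact: le_trans d0 (expR_ge0 _).
split; [apply: H (bl_fun_lip f) _|apply: H (bl_inv_lip f) _];
  by apply: le_trans fs; rewrite ?lerDl ?lerDr.
Qed.

Lemma near_isometry_epsIsometry (X Y : metricType R) (s : R) (f : biLipHomeo X Y) :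
  0 <= s -> near_isometry s f -> epsIsometry (s *+ 2) f.
Proof.
move=> s0 [fs gs]; rewrite /epsIsometry mulr2n lerD//.
  exact: normr_ln_dil s0 (bl_funK f) fs gs.
exact: normr_ln_dil s0 (bl_invK f) gs fs.
Qed.

Lemma near_isometryW (X Y : metricType R) (s s' : R) (f : biLipHomeo X Y) :
  s <= s' -> near_isometry s f -> near_isometry s' f.
Proof.
move=> ss' [fs gs]; split=> x x'; [apply: le_trans (fs x x') _|apply: le_trans (gs x x') _];
  by rewrite ler_wpM2r ?mdist_ge0// ler_expR.
Qed.

(** A sigma-type rather than an existential, so that compositions can be iterated by recursion in
    [limit_space]. *)
Lemma biLipHomeo_comp (X Y Z : metricType R) (f : biLipHomeo X Y) (g : biLipHomeo Y Z) :
  {h : biLipHomeo X Z | bl_fun h = (g \o f : continuousType _ _) &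
    bl_inv h = (bl_inv f \o bl_inv g : continuousType _ _)}.
Proof.
have hK : cancel (g \o f) (bl_inv f \o bl_inv g) by move=> x; rewrite /= !bl_funK.
have Kh : cancel (bl_inv f \o bl_inv g) (g \o f) by move=> x; rewrite /= !bl_invK.
have L (A B C : metricType R) (a : A -> B) (b : B -> C) : lipschitzMap a ->
    lipschitzMap b -> lipschitzMap (b \o a).
  move=> [k ak] [k' bk]; exists (`|k'| * k) => x x' /=.
  apply: le_trans (bk _ _) _; rewrite -mulrA.
  apply: le_trans (_ : `|k'| * mdist (a x) (a x') <= _).
    by rewrite ler_wpM2r ?mdist_ge0// ler_norm.
  by rewrite ler_wpM2l.
by exists (@BiLipHomeo R X Z (g \o f : continuousType _ _)
  (bl_inv f \o bl_inv g : continuousType _ _) hK Kh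
  (L _ _ _ _ _ (bl_fun_lip f) (bl_fun_lip g)) (L _ _ _ _ _ (bl_inv_lip g) (bl_inv_lip f))).
Qed.

Lemma near_isometry_comp (X Y Z : metricType R) (s s' : R) (f : biLipHomeo X Y)
    (g : biLipHomeo Y Z) : near_isometry s f -> near_isometry s' g ->
  near_isometry (s + s') (s2val (biLipHomeo_comp f g)).
Proof.
case: (biLipHomeo_comp f g) => h hE hiE [fs fis] [gs gis]; rewrite /near_isometry /= hE hiE.
split=> x x' /=; rewrite expRD.
  apply: le_trans (gs _ _) _; rewrite mulrAC mulrC ler_wpM2r ?expR_ge0//; exact: fs.
apply: le_trans (fis _ _) _; rewrite -mulrA ler_wpM2l ?expR_ge0//; exact: gis.
Qed.

End dilatation.

Section path_maps.
Context (R : realType) (T : R).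

Lemma Phi_lipschitz (X Y : compactMetric R) (f : continuousType X Y) (k : R) :
  0 <= k -> lipschitz_by k f -> lipschitz_by k (@Phi R T X Y f).
Proof.
move=> k0 fk v w; apply: dC_le => [|t]; first by rewrite mulr_ge0// mdist_ge0.
by apply: le_trans (fk _ _) _; rewrite ler_wpM2l// dC_ge.
Qed.

Lemma enlargement_Phi_preimage (X Y : compactMetric R) (f : continuousType X Y) (k a : R)
    (A : set (pathSpace T Y)) : 0 < k -> lipschitz_by k f ->
  enlargement (Phi f @^-1` A) a `<=` Phi f @^-1` (enlargement A (k * a)).
Proof.
move=> k0 fk v /enlargementP[w Aw vw]; apply/enlargementP; exists (Phi f w) => //.
by apply: le_lt_trans (Phi_lipschitz (ltW k0) fk v w) _; rewrite ltr_pM2l.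
Qed.

Definition Phi_law (X Y : compactMetric R) (f : continuousType X Y)
  (P : probability (pathSpace T X) R) : probability (pathSpace T Y) R :=
  image_law P (Phi_measurable f).

Lemma Phi_preimage_measurable (X Y : compactMetric R) (f : continuousType X Y)
  (A : set (pathSpace T Y)) : measurable A -> measurable (Phi f @^-1` A).
Proof. by move=> mA; rewrite -[X in measurable X]setTI; exact: Phi_measurable. Qed.

(** Enlarging a preimage by [a] stays inside the preimage of the enlargement by [k * a]; [1 <= k]
    absorbs the additive error. *)
Lemma prokhorov_le_Phi (X Y : compactMetric R) (f : continuousType X Y) (k a : R)
    (P Q : probability (pathSpace T X) R) : 1 <= k -> 0 <= a -> lipschitz_by k f ->
  prokhorov_le P Q a -> prokhorov_le (Phi_law f P) (Phi_law f Q) (k * a).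
Proof.
move=> k1 a0 fk PQ A mA; have k0 := lt_le_trans ltr01 k1.
change (P (Phi f @^-1` A) <= Q (Phi f @^-1` enlargement A (k * a)) + (k * a)%:E)%E.
apply: le_trans (PQ _ (Phi_preimage_measurable f mA)) _; apply: leeD.
  apply: le_measure; rewrite ?inE; first exact: enlargement_measurable.
    by apply: Phi_preimage_measurable; exact: enlargement_measurable.
  exact: enlargement_Phi_preimage.
by rewrite lee_fin ler_peMl.
Qed.

(** A version of the isomorphisms behind [dLP_pair] with one parameter and one inequality; the next
    two lemmas compare the two up to constant factors. *)
Definition close_laws (e : R) (p q : pathLaw T) :=
  exists2 f : biLipHomeo (pl_space p) (pl_space q), near_isometry e f &
    prokhorov_le (Phi_law f (pl_law p)) (pl_law q) e.

(** The factor [expR 1] bounds [expR s] in the radius [d * expR s], since [s <= e <= 1]. *)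
Lemma dLP_pair_close_laws (p q : pathLaw T) (e : R) : 0 < e <= 1 ->
  (dLP_pair p q < e%:E)%E -> close_laws (expR 1 * e) p q.
Proof.
move=> /andP[e0 e1] /ereal_inf_lt[_ [s [d [s0 d0 -> [f [fs [fP _]]]]]]].
rewrite lte_fin => sd; exists f.
  apply: near_isometryW (epsIsometry_near_isometry fs).
  rewrite (@le_trans _ _ e)//; first by lra.
  by apply: ler_peMl; [exact: ltW|rewrite -{1}expR0 ler_expR].
apply: (@prokhorov_leW _ _ _ _ _ (d * expR s)); last by move=> A mA; have [] := fP A mA.
rewrite mulrC ler_pM ?expR_ge0// ?ler_expR; lra.
Qed.

(** The parameters are [2 e] and [e]: [epsIsometry] adds the logarithms for the map and its inverse.
    The inequalities on the source are pulled back through the inverse, and the radius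
    [e * expR (2 e)] leaves room for its Lipschitz constant [expR e]. *)
Lemma close_laws_dLP_pair (p q : pathLaw T) (e : R) : 0 <= e -> close_laws e p q ->
  (dLP_pair p q <= (3 * e)%:E)%E.
Proof.
move=> e0 [f fe PQ]; apply: ereal_inf_lbound; exists (e *+ 2), e; split => //.
- exact: mulrn_wge0.
- by congr _%:E; lra.
have ee : expR e * e <= e * expR (e *+ 2).
  by rewrite mulrC ler_wpM2l// ler_expR mulr2n lerDl.
have e_le : e <= e * expR (e *+ 2).
  by rewrite ler_peMr// -expR0 ler_expR mulrn_wge0.
have leW P (a b c : R) (B : set (pathSpace T P)) (Q : probability (pathSpace T P) R) :
    a <= b -> c <= b -> (Q (enlargement B a) + c%:E <= Q (enlargement B b) + b%:E)%E.
  move=> ab cb; apply: leeD; rewrite ?lee_fin//.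
  by apply: le_measure; rewrite ?inE; try exact: enlargement_measurable; exact: enlargementS.
exists f; split; first exact: near_isometry_epsIsometry.
have [fl gl] := fe; split=> A mA.
  split; [apply: le_trans (PQ A mA) _|apply: le_trans (prokhorov_le_sym PQ mA) _]; exact: leW.
have mA' := Phi_preimage_measurable (bl_inv f) mA.
split.
  apply: le_trans (prokhorov_le_sym PQ mA') _.
  apply: le_trans (leW _ _ _ _ A (pl_law p) ee e_le); apply: leeD => //.
  change (pl_law p (Phi f @^-1` enlargement (Phi (bl_inv f) @^-1` A) e) <=
    pl_law p (enlargement A (expR e * e)))%E.
  apply: le_measure; rewrite ?inE; try exact: enlargement_measurable.
    by apply: Phi_preimage_measurable; exact: enlargement_measurable.
  move=> v /enlargementP[w Aw vw]; apply/enlargementP; exists (Phi (bl_inv f) w) => //.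
  rewrite -{1}[v](@PhiK _ T _ _ f (bl_inv f) (bl_funK f)).
  apply: le_lt_trans (Phi_lipschitz (expR_ge0 _) gl _ _) _.
  by rewrite ltr_pM2l ?expR_gt0.
have -> : A = Phi f @^-1` (Phi (bl_inv f) @^-1` A).
  by apply/seteqP; split => v /=; rewrite PhiK//; exact: bl_funK.
apply: le_trans (PQ _ mA') _; apply: leeD; rewrite ?lee_fin//.
rewrite /pushforward; apply: le_measure; rewrite ?inE; try exact: enlargement_measurable.
  by apply: Phi_preimage_measurable; exact: enlargement_measurable.
apply: subset_trans (enlargement_Phi_preimage (expR_gt0 _) gl) _.
rewrite (_ : Phi f @^-1` _ = A); last first.
  by apply/seteqP; split => v /=; rewrite PhiK//; exact: bl_funK.
by apply: preimage_subset; exact: enlargementS.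
Qed.

(** The first inequality is transported by the second map, whose Lipschitz constant [expR e'] is at
    most [expR 1]. *)
Lemma close_laws_trans (p q r : pathLaw T) (e e' : R) : 0 <= e -> 0 <= e' <= 1 ->
  close_laws e p q -> close_laws e' q r -> close_laws (expR 1 * e + e') p r.
Proof.
move=> e0 /andP[e'0 e'1] [f fe PQ] [g ge' QW].
have E1 : 1 <= expR 1 :> R by rewrite -{1}expR0 ler_expR.
exists (s2val (biLipHomeo_comp f g)).
  apply: near_isometryW (near_isometry_comp fe ge').
  by rewrite lerD2r ler_peMl.
case: (biLipHomeo_comp f g) => h /= hE _.
have PW : prokhorov_le (Phi_law g (Phi_law f (pl_law p))) (Phi_law g (pl_law q)) (expR 1 * e).
  apply: prokhorov_le_Phi PQ => // x x'; apply: le_trans (ge'.1 x x') _.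
  by rewrite ler_wpM2r ?mdist_ge0// ler_expR.
move=> A mA; apply: le_trans (prokhorov_le_trans PW QW mA).
rewrite le_eqVlt; apply/orP; left; apply/eqP; congr (pl_law p _).
by apply/seteqP; split => v /=; rewrite hE Phi_comp.
Qed.

End path_maps.

(** * Limits of metric spaces *)

Record is_distance (R : realType) (X : Type) (D : X -> X -> R) : Prop := IsDistance {
  distxx : forall x, D x x = 0 ;
  dist_positivity : forall x y, D x y = 0 -> x = y ;
  dist_sym : forall x y, D x y = D y x ;
  dist_triangle : forall y x z, D x z <= D x y + D y z }.

(** An alias indexed by the proof of the axioms, so that [D] becomes its canonical metric without
    clashing with that of [X]. *)
Definition remetric (R : realType) (X : choiceType) (D : X -> X -> R)
  of is_distance D : Type := X.

Section remetric.
Context (R : realType) (X : choiceType) (D : X -> X -> R) (dD : is_distance D).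

HB.instance Definition _ := Choice.on (remetric dD).

HB.instance Definition _ := @isMetric.Build R (remetric dD) D (distxx dD)
  (dist_positivity dD) (dist_sym dD) (dist_triangle dD).

End remetric.

Lemma remetrization (R : realType) (X : compactMetric R) (D : X -> X -> R) (k : R) :
  is_distance D -> (forall x y, D x y <= k * mdist x y) ->
  (forall x y, mdist x y <= k * D x y) ->
  exists (Y : compactMetric R) (j : biLipHomeo X Y),
    forall x y, mdist (j x) (j y) = D x y.
Proof.
move=> dD Dk kD; pose i : X -> remetric dD := id; pose i' : remetric dD -> X := id.
have ci : continuous i := @lipschitz_by_continuous R X (remetric dD) k i Dk.
have ci' : continuous i' := @lipschitz_by_continuous R (remetric dD) X k i' kD.
have [x0 _] := cm_nonempty X.
have Y0 : [set: remetric dD] !=set0 by exists x0.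
have cY : compact [set: remetric dD].
  rewrite (_ : [set: remetric dD] = i @` setT); last first.
    by apply/seteqP; split => x // _; exists x.
  by apply: continuous_compact; [exact: continuous_subspaceT|exact: cm_compact].
exists (CompactMetric Y0 cY).
by exists (@BiLipHomeo R X (CompactMetric Y0 cY) (mkcts ci : continuousType _ _)
  (mkcts ci' : continuousType _ _) (fun=> erefl) (fun=> erefl)
  (ex_intro _ k Dk) (ex_intro _ k kD)).
Qed.

Section limits.
Context (R : realType).

Notation half n := ((2 ^+ n)^-1 : R).

Lemma half_gt0 n : 0 < half n. Proof. by rewrite invr_gt0 exprn_gt0. Qed.

Lemma halfS n : half n = half n.+1 *+ 2.
Proof. by rewrite exprS -mulr_natl; field; rewrite expf_neq0. Qed.

Lemma half_noninc n m : (n <= m)%N -> half m <= half n.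
Proof. by move=> nm; rewrite lef_pV2 ?posrE ?exprn_gt0// ler_eXn2l ?ltr1n. Qed.

Lemma half_small (e : R) : 0 < e -> exists n, half n < e.
Proof.
move=> e0; exists (Num.truncn e^-1).+1; rewrite invf_plt ?posrE ?exprn_gt0//.
by rewrite (lt_trans (truncnS_gt _))// -natrX ltr_nat ltn_expl.
Qed.

(** Otherwise [ln (x / y)] would be positive and yet at most [c * half n] for every [n]. *)
Lemma ler_expR_half (c x y : R) : 0 <= c -> 0 <= y -> (forall n, x <= expR (c * half n) * y) ->
  x <= y.
Proof.
move=> c0 y0 xy; rewrite leNgt; apply/negP => yx.
have x0 : 0 < x by exact: le_lt_trans yx.
have {}y0 : 0 < y.
  by rewrite lt_neqAle y0 andbT; apply/eqP => y_0; have := xy 0%N;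
    rewrite -y_0 mulr0 leNgt x0.
have l0 : 0 < ln (x / y) by rewrite ln_gt0// ltr_pdivlMr// mul1r.
have c1 : 0 < c + 1 by rewrite ltr_wpDl.
have [n] := half_small (divr_gt0 l0 c1); rewrite ltr_pdivlMr// => Hn.
have := xy n; rewrite -ler_pdivrMr// -{1}[x / y]lnK ?posrE ?divr_gt0// ler_expR.
by have := half_gt0 n; lra.
Qed.

Lemma slowly_varying_limit (a : nat -> R) : (forall n, 0 <= a n) ->
  (forall n, a n.+1 <= expR (half n) * a n) ->
  (forall n, a n <= expR (half n) * a n.+1) ->
  exists l, forall n, l <= expR (2 * half n) * a n /\ a n <= expR (2 * half n) * l.
Proof.
(* [lo] increases and [up] decreases because [2 half n = half n + 2 half n.+1]. *)
move=> a0 aS Sa; pose E n := expR (2 * half n).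
have E0 n : 0 < E n by exact: expR_gt0.
have ES n : E n = expR (half n) * E n.+1.
  by rewrite /E -expRD; congr expR; have := halfS n; lra.
pose lo n := a n / E n; pose up n := E n * a n.
have E1 n : 1 <= E n by rewrite /E -expR0 ler_expR mulr_ge0// ltW// half_gt0.
have lo_up n : lo n <= up n.
  rewrite /lo /up ler_pdivrMr// -[leLHS]mul1r mulrAC ler_wpM2r// -expr2.
  by rewrite expr_ge1// ?ltW.
have loS n m : (n <= m)%N -> lo n <= lo m.
  move=> /subnKC <-; elim: (m - n)%N => [|k IH]; first by rewrite addn0.
  apply: le_trans IH _; rewrite addnS /lo ES invfM mulrA ler_pM2r ?invr_gt0//.
  by rewrite ler_pdivrMr ?expR_gt0// mulrC; exact: Sa.
have upS n m : (n <= m)%N -> up m <= up n.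
  move=> /subnKC <-; elim: (m - n)%N => [|k IH]; first by rewrite addn0.
  by apply: le_trans IH; rewrite addnS /up (ES (n + k)%N) -mulrA [leRHS]mulrCA ler_pM2l.
have lo_up' n m : lo n <= up m.
  apply: le_trans (loS n (maxn n m) (leq_maxl _ _)) (le_trans (lo_up _) _).
  exact: upS (leq_maxr _ _).
exists (sup (range lo)) => n; split.
  by apply: ge_sup; [exists (lo 0%N), 0%N|move=> _ [m _ <-]; exact: lo_up'].
rewrite mulrC -ler_pdivrMr//; apply: ub_le_sup; last by exists n.
by exists (up 0%N) => _ [m _ <-]; exact: lo_up'.
Qed.

(** Distances pulled back to [X 0] by [F n] have a limit [D]. Passing from [D] to stage [n] and back
    costs [expR (4 * half n)], so symmetry and the triangle inequality hold up to that factor for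
    all [n], hence exactly; positivity comes from stage [0]. [G n] is the inverse of [F n] followed
    by [j]. *)
Lemma limit_space (X : nat -> compactMetric R) (f : forall n, biLipHomeo (X n) (X n.+1)) :
  (forall n, near_isometry (half n) (f n)) ->
  exists (Y : compactMetric R) (G : forall n, biLipHomeo (X n) Y),
    (forall n, near_isometry (2 * half n) (G n)) /\
    (forall n x, G n.+1 (f n x) = G n x).
Proof.
move=> fh.
have [F [F0 FS FiS]] : exists F : forall n, biLipHomeo (X 0%N) (X n),
    [/\ forall x, F 0%N x = x, forall n x, F n.+1 x = f n (F n x) &
        forall n x, bl_inv (F n.+1) x = bl_inv (F n) (bl_inv (f n) x)].
  have cid0 : continuous (fun x : X 0%N => x) by move=> x.
  have id_lip : lipschitzMap (fun x : X 0%N => x) by exists 1 => x x'; rewrite mul1r.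
  pose id0 := @BiLipHomeo R (X 0%N) (X 0%N) (mkcts cid0 : continuousType _ _)
    (mkcts cid0 : continuousType _ _) (fun=> erefl) (fun=> erefl) id_lip id_lip.
  exists (nat_rect (fun n => biLipHomeo (X 0%N) (X n)) id0
    (fun n g => s2val (biLipHomeo_comp g (f n)))).
  by split=> // n x /=; case: biLipHomeo_comp => h /= hE hiE; rewrite ?hE ?hiE.
pose a (x y : X 0%N) n := mdist (F n x) (F n y).
have /choice[D' D'P] : forall q : X 0%N * X 0%N, exists l, forall n,
    l <= expR (2 * half n) * a q.1 q.2 n /\ a q.1 q.2 n <= expR (2 * half n) * l.
  move=> [x y]; apply: slowly_varying_limit => n; rewrite /a /=.
  - exact: mdist_ge0.
  - by rewrite !FS; exact: (fh n).1.
  - by have := (fh n).2 (F n.+1 x) (F n.+1 y); rewrite !FS !bl_funK.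
pose D x y := D' (x, y).
have DP x y n : D x y <= expR (2 * half n) * a x y n by exact: (D'P (x, y) n).1.
have PD x y n : a x y n <= expR (2 * half n) * D x y by exact: (D'P (x, y) n).2.
have a0 x y n : 0 <= a x y n by exact: mdist_ge0.
have D0 x y : 0 <= D x y.
  by rewrite -(pmulr_rge0 _ (expR_gt0 (2 * half 0))); exact: le_trans (PD x y 0%N).
have E0 (s : R) : 0 <= expR s := expR_ge0 s.
have E4 n : expR (2 * half n) * expR (2 * half n) = expR (4 * half n).
  by rewrite -expRD; congr expR; lra.
have aD x y n z : z <= expR (2 * half n) * a x y n -> z <= expR (4 * half n) * D x y.
  by move=> /le_trans; apply; rewrite -E4 -mulrA ler_wpM2l.
have dD : is_distance D.
  split=> [x|x y D_0|x y|y x z].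
  - apply/eqP; rewrite eq_le D0 andbT; apply: le_trans (DP x x 0%N) _.
    by rewrite /a mdistxx mulr0.
  - apply: mdist_positivity; apply/eqP; rewrite eq_le mdist_ge0 andbT.
    by have := PD x y 0%N; rewrite /a !F0 D_0 mulr0.
  - suff H u v : D u v <= D v u by apply/eqP; rewrite eq_le !H.
    apply: (@ler_expR_half 4) => // n; apply: aD.
    by rewrite /a metric_sym; exact: DP.
  - apply: (@ler_expR_half 4) => // [|n]; first exact: addr_ge0.
    apply: le_trans (DP x z n) _; rewrite -E4 -mulrA ler_wpM2l// mulrDr.
    apply: le_trans (metric_triangle _ (F n y) _) _.
    by rewrite lerD//; exact: PD.
have [||Y [j jD]] := @remetrization R (X 0%N) D (expR (2 * half 0)) dD.
- by move=> x y; have := DP x y 0%N; rewrite /a !F0.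
- by move=> x y; have := PD x y 0%N; rewrite /a !F0.
exists Y, (fun n => s2val (biLipHomeo_comp (biLipHomeo_sym (F n)) j)); split=> n.
  rewrite /near_isometry; case: biLipHomeo_comp => h /= -> ->; split => x y /=.
    rewrite jD; apply: le_trans (DP _ _ n) _.
    by rewrite /a !bl_invK.
  have := PD (bl_inv j x) (bl_inv j y) n.
  by rewrite -jD !bl_invK.
move=> x; do 2 case: biLipHomeo_comp => ? /= -> _ /=.
by rewrite FiS bl_funK.
Qed.

End limits.

(** * Completeness of the Lipschitz--Prokhorov metric *)

Theorem theorem2p7 (R : realType) (T : R) (T_gt0 : 0 < T) (u : nat -> PM T) :
  (forall e : R, 0 < e -> exists N : nat, forall m n : nat,
     (N <= m)%N -> (N <= n)%N -> (dLP (u m) (u n) < e%:E)%E) ->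
  exists x : PM T, dLP (u n) x @[n --> \oo] --> (0 : \bar R)%E.
Proof.
move=> cauchy_u; pose p n := PM_repr (u n); pose h n := (2 ^+ n)^-1 : R.
have h0 n : 0 < h n := half_gt0 R n.
have E0 : 0 < expR 1 :> R := expR_gt0 1.
have E1 : 1 <= expR 1 :> R by rewrite -{1}expR0 ler_expR.
have h1 n : h n <= 1 by rewrite -[leRHS]invr1; exact: (half_noninc R (leq0n n)).
have /choice[N NP] : forall j, exists N, forall m n, (N <= m)%N -> (N <= n)%N ->
    close_laws (h j) (p m) (p n).
  move=> j; have hE : 0 < h j / expR 1 by rewrite divr_gt0.
  have [N NP] := cauchy_u _ hE; exists N => m n Nm Nn.
  rewrite -[h j](divfK (lt0r_neq0 E0)) mulrC; apply: dLP_pair_close_laws.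
    by rewrite hE ler_pdivrMr// mul1r (le_trans (h1 j)).
  exact: NP.
(* Partial sums give a nondecreasing sequence of indices that dominates [N]. *)
pose k j := (\sum_(i < j.+1) N i)%N.
have Nk j : (N j <= k j)%N by rewrite /k big_ord_recr leq_addl.
have kS j : (k j <= k j.+1)%N by rewrite /k [leqRHS]big_ord_recr leq_addr.
pose X j := pl_space (p (k j)).
have fP j : exists f : biLipHomeo (X j) (X j.+1), near_isometry (h j) f /\
    prokhorov_le (Phi_law f (pl_law (p (k j)))) (pl_law (p (k j.+1))) (h j).
  have [f fh fP] := NP j (k j) (k j.+1) (Nk j) (leq_trans (Nk j) (kS j)).
  by exists f.
pose f j := projT1 (cid (fP j)).
have [fh fprok] := all_and2 (fun j => projT2 (cid (fP j))).
have [Y [G [GP Gf]]] := limit_space fh.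
pose mu j := Phi_law (T := T) (G j) (pl_law (p (k j))).
(* [G j.+1] has Lipschitz constant at most [expR (2 * h j.+1) = expR (h j) <= expR 1], and composing
   it with [f j] gives [G j]. *)
have muP j : prokhorov_le (mu j) (mu j.+1) (expR 1 / 2 ^+ j).
  have G1 : lipschitz_by (expR 1) (G j.+1).
    move=> x x'; apply: le_trans ((GP j.+1).1 x x') _.
    rewrite ler_wpM2r ?mdist_ge0// ler_expR.
    by have := halfS R j; have := h1 j; rewrite /h; lra.
  move=> A mA; have := prokhorov_le_Phi E1 (ltW (h0 j)) G1 (fprok j) mA.
  rewrite (_ : Phi_law _ _ A = mu j A)//; congr (pl_law _ _).
  by apply/seteqP; split => v /=; rewrite -Phi_comp (_ : (_ \o _ : continuousType _ _) = G j)//;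
    apply/continuousEP => x; exact: Gf.
have [Q [K [K0 QP]]] := prokhorov_complete T_gt0 E0 muP.
pose q := PathLaw Q; exists (PM_pi q).
have dE n : dLP (u n) (PM_pi q) = dLP_pair (p n) q.
  by rewrite -{1}(PM_reprK (u n)) dLP_pi.
have close_q j : close_laws ((K + 2) * h j) (p (k j)) q.
  exists (G j).
    apply: near_isometryW (GP j); rewrite ler_wpM2r ?(ltW (h0 j))//; lra.
  apply: prokhorov_leW (QP j); rewrite ler_wpM2r ?(ltW (h0 j))//; lra.
(* For [n >= N j], [p n] is close to [p (k j)], which is close to [q]. [C] collects the constants of
   [close_laws_trans] and [close_laws_dLP_pair]; the bound by [(K + 2)^-1] meets the condition
   [e' <= 1] of the former. *)
have dsmall e : 0 < e -> exists N0, forall n, (N0 <= n)%N -> (dLP (u n) (PM_pi q) < e%:E)%E.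
  move=> e0; pose C := 3 * (expR 1 + (K + 2)); have C0 : 0 < C by rewrite /C; lra.
  have K2 : 0 < K + 2 by lra.
  have me0 : 0 < Num.min (e / C) (K + 2)^-1 by rewrite lt_min divr_gt0// invr_gt0.
  have [j] := half_small me0; rewrite lt_min => /andP[je jK].
  exists (N j) => n Nn; rewrite dE.
  have Kh : 0 <= (K + 2) * h j <= 1.
    rewrite mulr_ge0 ?(ltW K2) ?(ltW (h0 j))//=.
    by rewrite mulrC -ler_pdivlMr// mul1r ltW.
  have := close_laws_trans (ltW (h0 j)) Kh (NP j n (k j) Nn (Nk j)) (close_q j).
  move=> /close_laws_dLP_pair => /(_ _)/le_lt_trans; apply.
    by rewrite addr_ge0 ?mulr_ge0 ?(ltW E0) ?(ltW (h0 j)) ?(ltW K2).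
  rewrite lte_fin -mulrDl mulrA -/C mulrC -ltr_pdivlMr//.
have d_ge0 n : (0 <= dLP (u n) (PM_pi q))%E.
  rewrite dE; apply: le_ereal_inf_tmp => _ [e [d [e0 d0 -> _]]]; rewrite lee_fin; exact: addr_ge0.
move=> A [e /= e0 eA]; have [N0 N0P] := dsmall e e0.
exists N0 => // n /= /N0P; have := d_ge0 n.
case: (dLP _ _) => [r| |]//; rewrite lee_fin lte_fin => r0 re.
by apply: eA; rewrite /= sub0r normrN ger0_norm.
Qed.
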